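(* For every real $p\ge 1$, the Fuss-Catalan distribution $\mu(p,p-1)$ is unimodal.
   Context: Fuss-Catalan distributions: for real $p,r$ put $A_0(p,r)=1$ and $A_k(p,r)=\frac{r}{k!}\prod_{i=1}^{k-1}(kp+r-i)$ for $k\ge 1$. For $p\ge 1$, $0\le r\le p$, it is known that there is a unique compactly supported Borel probability measure $\mu(p,r)$ on $\mathbb{R}$ with $\int x^k\,\mu(p,r)(dx)=A_k(p,r)$ for all $k\ge 0$. It is the Fuss-Catalan distribution. In particular $\mu(p,0)=\delta_0$. A measure $\rho$ on $\mathbb{R}$ is unimodal if there are $a\in\mathbb{R}$ (the mode), $c\ge 0$ and a function $f\ge 0$, non-decreasing on $(-\infty,a)$ and non-increasing on $(a,\infty)$, with $\rho(dx)=c\,\delta_a(dx)+f(x)\,dx$. *)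

(* Defs.v *)
From HB Require Import structures.
From mathcomp Require Import all_boot all_order all_algebra.
From mathcomp Require Import all_classical all_reals all_analysis.
Import Order.TTheory GRing.Theory Num.Theory.
Import numFieldNormedType.Exports.
Set Implicit Arguments.
Unset Strict Implicit.
Unset Printing Implicit Defensive.
Local Open Scope classical_set_scope.
Local Open Scope ring_scope.

Definition fuss_catalan_number (R : realType) (p r : R) (k : nat) : R :=
  if k is 0 then 1
  else r / (k`!)%:R * \prod_(1 <= i < k) (k%:R * p + r - i%:R).

(* The unique mu satisfying this predicate, for 1 <= p and 0 <= r <= p, is the
   Fuss-Catalan distribution mu(p, r).  Integrability of the monomials follows
   from the compact support. *)
Definition is_fuss_catalan_distribution (R : realType) (p r : R)
    (mu : probability (measurableTypeR R) R) : Prop :=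
  (exists2 K : set R, compact K & mu (~` K) = 0%E) /\
  (forall k : nat,
     (\int[mu]_x (x ^+ k)%:E = (fuss_catalan_number p r k)%:E)%E).

(* f a is left unconstrained, and f is automatically Borel measurable, being
   monotone on each side of a. *)
Definition unimodal (R : realType)
    (rho : {measure set (measurableTypeR R) -> \bar R}) : Prop :=
  exists (a c : R) (f : R -> R),
    [/\ 0 <= c,
        forall x, 0 <= f x,
        {in `]-oo, a[ &, {homo f : x y / x <= y}},
        {in `]a, +oo[ &, {homo f : x y / x <= y >-> y <= x}} &
        forall A : set (measurableTypeR R), measurable A ->
          (rho A = c%:E * \d_a A + \int[lebesgue_measure]_(x in A) (f x)%:E)%E].

(* Main.v *)
Require Import Defs.
From HB Require Import structures.
From mathcomp Require Import all_boot all_order all_algebra.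
From mathcomp Require Import all_classical all_reals all_analysis.
From mathcomp Require Import measurable_realfun ring lra.
Import Order.TTheory GRing.Theory Num.Theory.
Import numFieldNormedType.Exports.
Local Open Scope classical_set_scope.
Local Open Scope ring_scope.

(** For p = 1 the second moment vanishes, hence mu is the Dirac mass at 0.

    For p > 1 put s = 1/p and, for 0 < t < pi,
      B = e^(i s t) sin t / sin ((1 - s) t),  z = B - 1 = e^(i t) sin (s t) / sin ((1 - s) t),
    so that rho = B^p / z > 0 is real.  The numbers (k + 1) A_k(p, p - 1) = C(k p + p - 2, k)
    are contour integrals of B^(n p - 2) / z^n dB = rho^n dB / B^2, n = k + 1,
    hence the moments int rho^n weight dt, where pi * weight = d/dt Im (- 1/B) >= 0.
    Consequently A_k is the k-th moment of the mixture of the uniform laws on ]0, rho t]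
    with weights rho t * weight t dt; its density is non-increasing on ]0, +oo[, and it is
    mu because compactly supported measures are determined by their moments.

    The contour integrals are reduced to int Im (B^a dz / z) = pi, a > 0, by integration by
    parts (only imaginary parts matter, and the end points of the contour are real).  The form
    B^a dz / z is closed in the two variables (s, t), so this integral does not depend on s, and
    it tends to pi when s tends to 0, where B tends to 1 and z has argument t. *)

Set Implicit Arguments.
Unset Strict Implicit.
Unset Printing Implicit Defensive.

(** By Khintchine's criterion a law is unimodal with mode 0 exactly when it is the law of [U Y] with
    [U] uniform on [[0, 1]] and independent of [Y]. Its moments are those of [Y] divided by [k + 1];
    hence the interest in [(k + 1) A_k], for which a nonnegative weight has to be found. The curve
    comes from the generating function of the numbers [A_k(p, 1)], which solves [B = 1 + x B^p]:
    putting [x = 1 / rho] with [rho > 0] and solving for complex [B] in polar form gives the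
    parametrisation by [t]. For real [p] the powers of [B] are multivalued; keeping modulus and
    argument as explicit real functions of [s] and [t] fixes the branch. Two obstacles shape the
    estimates. For [1 < p < 2] the integrand [rho * weight] is unbounded near [t = pi], so its
    integrability has to be drawn from positivity. And the bounds valid at a fixed [s] degenerate
    when [s] tends to 0, so that this limit needs estimates of its own. *)

Section is_derive_lambda.
Context {R : realType}.
Implicit Types (f g : R -> R) (x a b c : R).

(** The rules are stated for pointwise lambdas, so that derivatives of long explicit formulas can be
    assembled as proof terms and adjusted by [is_derive_eq]. *)
Lemma is_derive_add f g x a b : is_derive x 1 f a -> is_derive x 1 g b ->
  is_derive x 1 (fun y => f y + g y) (a + b).
Proof. by move=> ? ?; exact: is_deriveD. Qed.

Lemma is_derive_sub f g x a b : is_derive x 1 f a -> is_derive x 1 g b ->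
  is_derive x 1 (fun y => f y - g y) (a - b).
Proof. by move=> ? ?; exact: is_deriveB. Qed.

Lemma is_derive_mul f g x a b : is_derive x 1 f a -> is_derive x 1 g b ->
  is_derive x 1 (fun y => f y * g y) (a * g x + f x * b).
Proof.
move=> fa gb; apply: (@is_derive_eq _ _ _ (f * g)).
by rewrite /GRing.scale /= addrC mulrC.
Qed.

Lemma is_derive_mulc c f x a : is_derive x 1 f a ->
  is_derive x 1 (fun y => c * f y) (c * a).
Proof. by move=> fa; exact: is_deriveZ. Qed.

Lemma is_derive_idR x : is_derive x 1 (fun y : R => y) 1.
Proof. exact: is_derive_id. Qed.

Lemma is_derive_cstR c x : is_derive x 1 (fun=> c) 0.
Proof. exact: is_derive_cst. Qed.

Lemma is_derive_expR_comp f x a : is_derive x 1 f a ->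
  is_derive x 1 (fun y => expR (f y)) (a * expR (f x)).
Proof.
by move=> fa; rewrite mulrC; exact: (@is_derive1_comp _ expR f).
Qed.

Lemma is_derive_sin_comp f x a : is_derive x 1 f a ->
  is_derive x 1 (fun y => sin (f y)) (a * cos (f x)).
Proof. by move=> fa; rewrite mulrC; exact: (@is_derive1_comp _ sin f). Qed.

Lemma is_derive_cos_comp f x a : is_derive x 1 f a ->
  is_derive x 1 (fun y => cos (f y)) (- (a * sin (f x))).
Proof.
by move=> fa; rewrite mulrC -mulNr; exact: (@is_derive1_comp _ cos f).
Qed.

Lemma is_derive_inv_comp f x a : f x != 0 -> is_derive x 1 f a ->
  is_derive x 1 (fun y => (f y)^-1) (- (a / f x ^+ 2)).
Proof.
move=> fx0 fa; apply: DeriveDef; first exact: derivableV.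
by rewrite deriveV// derive_val /GRing.scale/= mulNr mulrC.
Qed.

Definition cot x : R := cos x / sin x.

Lemma is_derive_cot_comp f x a : sin (f x) != 0 -> is_derive x 1 f a ->
  is_derive x 1 (fun y => cot (f y)) (- (a / sin (f x) ^+ 2)).
Proof.
move=> fx0 fa.
have h := is_derive_mul (is_derive_cos_comp fa)
  (is_derive_inv_comp fx0 (is_derive_sin_comp fa)).
apply: (is_derive_eq h); rewrite -[X in _ = - (X / _)]mulr1.
by rewrite -(cos2Dsin2 (f x)); field.
Qed.

Lemma is_derive_lnsin_comp f x a : 0 < sin (f x) -> is_derive x 1 f a ->
  is_derive x 1 (fun y => ln (sin (f y))) (a * cot (f x)).
Proof.
move=> fx0 fa.
have h := @is_derive1_comp _ (@ln R) (fun y => sin (f y)) x _ _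
  (is_derive1_ln fx0) (is_derive_sin_comp fa).
by apply: (is_derive_eq h); rewrite /cot mulrC mulrA.
Qed.

End is_derive_lambda.

(** * Fundamental theorem of calculus on an open interval *)

Section FTC.
Context {R : realType}.
Notation mu := (@lebesgue_measure R).

Lemma itvoo_bigcup_cc (a b : R) : a < b ->
  `]a, b[%classic =
  \bigcup_n `[a + (b - a) / n.+3%:R, b - (b - a) / n.+3%:R]%classic.
Proof.
move=> ab; apply/seteqP; split => [x /=|x [n _ /=]]; last first.
  have : 0 < (b - a) / n.+3%:R by rewrite divr_gt0// subr_gt0.
  move: (_ / _) => e e0.
  by rewrite !in_itv/= => /andP[h1 h2]; apply/andP; split; lra.
rewrite in_itv/= => /andP[ax xb].
pose d := Num.min (x - a) (b - x).
have d0 : 0 < d by rewrite lt_min !subr_gt0 ax.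
have [n Hn] : exists n : nat, (b - a) / d < n.+3%:R.
  exists (Num.truncn ((b - a) / d)).
  apply: (lt_le_trans (truncnS_gt _)).
  by rewrite ler_nat; do 2 apply: leqW.
exists n => //=; rewrite in_itv/=.
have : (b - a) / n.+3%:R < d.
  by rewrite ltr_pdivrMr// mulrC -ltr_pdivrMr.
rewrite lt_min; move: (_ / _) => e /andP[h1 h2].
by apply/andP; split; lra.
Qed.

(** Monotone convergence along segments exhausting []a, b[]. Positivity of [g] stands in for
    integrability, so [g] may blow up at the end points. *)
Lemma ge0_FTC_oo (g F : R -> R) (a b la lb : R) : a < b ->
  (forall x, x \in `]a, b[ -> 0 <= g x) ->
  (forall x, x \in `]a, b[ -> {for x, continuous g}) ->
  (forall x, x \in `]a, b[ -> is_derive x 1 F (g x)) ->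
  F x @[x --> a^'+] --> la -> F x @[x --> b^'-] --> lb ->
  (\int[mu]_(x in `]a, b[) (g x)%:E = (lb - la)%:E)%E.
Proof.
move=> ab g0 cg dF Fa Fb.
(* The offset 3 makes [d n] smaller than half the length already for [n = 0], so every segment is
   nondegenerate. *)
pose d n : R := (b - a) / n.+3%:R.
have d0 n : 0 < d n by rewrite divr_gt0// subr_gt0.
have dhalf n : d n < (b - a) / 2.
  by rewrite ltr_pM2l ?subr_gt0// ltf_pV2 ?posrE// ltr_nat.
have d_cvg : d n @[n --> \oo] --> 0.
  rewrite -[X in _ --> X](mulr0 (b - a)); apply: cvgM; first exact: cvg_cst.
  have := @cvg_harmonic R; rewrite -(cvg_shiftn 2) => h.
  apply: cvg_trans h; apply: near_eq_cvg; near=> n.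
  by rewrite /harmonic /= addn2.
pose I n : set R := `[a + d n, b - d n]%classic.
have sI n x : I n x -> x \in `]a, b[.
  rewrite /I /= !in_itv/= => /andP[h1 h2]; have := d0 n.
  by move=> ?; apply/andP; split; lra.
have nI : nondecreasing_seq I.
  move=> m n mn; apply/subsetPset => x; rewrite /I /= !in_itv/= => /andP[h1 h2].
  have : d n <= d m.
    by rewrite /d ler_pM2l ?subr_gt0// lef_pV2 ?posrE// ler_nat !ltnS.
  by move=> ?; apply/andP; split; lra.
have mg : measurable_fun `]a, b[%classic g.
  apply: open_continuous_measurable_fun; first exact: itv_open.
  by move=> x; rewrite inE/=; exact: cg.
have cI : (\int[mu]_(x in I i) (g x)%:E)%E @[i --> \oo] -->
    (\int[mu]_(x in `]a, b[) (g x)%:E)%E.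
  rewrite (itvoo_bigcup_cc ab).
  apply: (@ge0_nondecreasing_set_cvg_integral _ (measurableTypeR R) R I
    (fun x => (g x)%:E) mu) => //.
  - by move=> n; exact: measurable_itv.
  - move=> n; apply/measurable_EFinP; apply: measurable_funS mg => //.
    by move=> x /sI.
  - by move=> n x /sI /g0; rewrite lee_fin.
have eI n : (\int[mu]_(x in I n) (g x)%:E = (F (b - d n) - F (a + d n))%:E)%E.
  rewrite EFinB; apply: continuous_FTC2.
  - by have := dhalf n; lra.
  - apply: continuous_in_subspaceT => x; rewrite inE => xI.
    by apply: cg; exact: sI xI.
  - have dc x : x \in `[a + d n, b - d n] -> derivable F x 1.
      by move=> xI; have /dF h := sI n x xI; exact: ex_derive.
    have := dhalf n => dn.
    have : {within `[a + d n, b - d n], continuous F}.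
      by apply: derivable_within_continuous.
    move/continuous_within_itvP => []; first by lra.
    move=> _ h1 h2; split => // x xI; apply: dc.
    exact: subset_itv_oo_cc xI.
  - move=> x xI; rewrite derive1E.
    have /dF h : x \in `]a, b[ by apply: (sI n); apply: subset_itv_oo_cc xI.
    exact: derive_val.
have Fcvg : (F (b - d n) - F (a + d n))%:E @[n --> \oo] --> (lb - la)%:E.
  apply: cvg_EFin; first exact: nearW.
  apply: cvgB.
  - move/cvg_at_leftP: Fb; apply; split.
      by move=> n; have := d0 n; lra.
    by rewrite -[X in _ --> X]subr0; apply: cvgB => //; exact: cvg_cst.
  - move/cvg_at_rightP: Fa; apply; split.
      by move=> n; have := d0 n; lra.
    by rewrite -[X in _ --> X]addr0; apply: cvgD => //; exact: cvg_cst.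
have := cvg_lim _ cI => <-//.
under eq_fun do rewrite eI.
exact/cvg_lim.
Unshelve. all: by end_near. Qed.

(** Apply [ge0_FTC_oo] to [g + C >= 0], with primitive [F x + C * x]: its integral is finite, hence
    [g] is integrable. The bound is one-sided because in [moment_rho] the integrand can be unbounded
    above near [pi]. *)
Lemma FTC_oo_vanish (g F : R -> R) (a b C : R) : a < b ->
  (forall x, x \in `]a, b[ -> - C <= g x) ->
  (forall x, x \in `]a, b[ -> {for x, continuous g}) ->
  (forall x, x \in `]a, b[ -> is_derive x 1 F (g x)) ->
  F x @[x --> a^'+] --> 0 -> F x @[x --> b^'-] --> 0 ->
  mu.-integrable `]a, b[ (EFin \o g) /\ \int[mu]_(x in `]a, b[) g x = 0.
Proof.
move=> ab gC cg dF Fa Fb.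
have mD : measurable (`]a, b[%classic : set R) by exact: measurable_itv.
have muD : mu `]a, b[%classic = (b - a)%:E.
  by rewrite lebesgue_measure_itv/= lte_fin ab EFinB.
have icst (c : R) : mu.-integrable `]a, b[ (EFin \o cst c).
  apply: measurable_bounded_integrable => //.
  - by rewrite -[X in (X < _)%E]/(mu _) muD ltry.
  - exact: bounded_cst.
have h1 : (\int[mu]_(x in `]a, b[) (g x + C)%:E = (C * b - C * a)%:E)%E.
  apply: (@ge0_FTC_oo (fun x => g x + C) (fun x => F x + C * x)) => //.
  - by move=> x /gC; lra.
  - by move=> x xI; apply: cvgD; [exact: cg|exact: cvg_cst].
  - move=> x xI.
    have h := is_derive_add (dF x xI) (is_derive_mulc C (is_derive_idR x)).
    by apply: (is_derive_eq h); rewrite mulr1.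
  - rewrite -[X in _ --> X]add0r; apply: cvgD => //.
    apply: cvgM; first exact: cvg_cst.
    by apply: cvg_at_right_filter; exact: cvg_id.
  - rewrite -[X in _ --> X]add0r; apply: cvgD => //.
    apply: cvgM; first exact: cvg_cst.
    by apply: cvg_at_left_filter; exact: cvg_id.
have mg : measurable_fun `]a, b[%classic g.
  apply: open_continuous_measurable_fun; first exact: itv_open.
  by move=> x; rewrite inE/=; exact: cg.
have ig : mu.-integrable `]a, b[ (EFin \o (fun x => g x + C)).
  apply/integrableP; split.
    by apply/measurable_EFinP; apply: measurable_funD => //; exact: measurable_cst.
  under eq_integral => x.
    rewrite inE /= => /gC h; rewrite ger0_norm; last by lra.
    over.
  by rewrite h1 ltry.
have ig' : mu.-integrable `]a, b[ (EFin \o g).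
  have : mu.-integrable `]a, b[ ((EFin \o (fun x => (g x + C)%R)) \- (EFin \o cst C))%E.
    exact: integrableB.
  by apply: eq_integrable => // x _ /=; rewrite -EFinB addrK.
split=> //.
have : \int[mu]_(x in `]a, b[) (g x + C) = C * b - C * a.
  by rewrite /Rintegral h1.
rewrite RintegralD//; last exact: (icst C).
rewrite (@Rintegral_cst _ _ _ mu _ mD) [X in fine X]muD/=; lra.
Qed.

End FTC.

(** * The contour *)

Section contour.
Context {R : realType}.
Implicit Types (m j a s t : R).

(* logB and logz are ln |B| and ln |z|, dlogB and dlogz their t-derivatives, and
   modBz, ReBz, ImBz the modulus and the real and imaginary parts of B^m z^-j. *)
Definition logB s t : R := ln (sin t) - ln (sin ((1 - s) * t)).
Definition logz s t : R := ln (sin (s * t)) - ln (sin ((1 - s) * t)).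
Definition dlogB s t : R := cot t - (1 - s) * cot ((1 - s) * t).
Definition dlogz s t : R := s * cot (s * t) - (1 - s) * cot ((1 - s) * t).

Definition modBz m j s t : R := expR (m * logB s t - j * logz s t).
Definition ReBz m j s t : R := modBz m j s t * cos ((m * s - j) * t).
Definition ImBz m j s t : R := modBz m j s t * sin ((m * s - j) * t).

(* Im (B^m z^-j dz / z), as dz / z = (dlogz + i) dt *)
Definition cform m j s t : R := ReBz m j s t + dlogz s t * ImBz m j s t.

Section pointwise.
Variables s t : R.
Hypotheses (s01 : 0 < s < 1) (t0pi : 0 < t < pi).

Lemma st_itv : 0 < s * t < pi.
Proof.
case/andP: s01 => s0 s1; case/andP: t0pi => t0 tpi.
by rewrite mulr_gt0//= (lt_trans _ tpi)// gtr_pMl.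
Qed.

Lemma onem_st_itv : 0 < (1 - s) * t < pi.
Proof.
case/andP: s01 => s0 s1; case/andP: t0pi => t0 tpi.
by rewrite mulr_gt0 ?subr_gt0//= (lt_trans _ tpi)// gtr_pMl//; lra.
Qed.

Lemma sin_t_gt0 : 0 < sin t. Proof. exact: sin_gt0_pi. Qed.
Lemma sin_st_gt0 : 0 < sin (s * t). Proof. exact: (sin_gt0_pi st_itv). Qed.
Lemma sin_onem_st_gt0 : 0 < sin ((1 - s) * t).
Proof. exact: (sin_gt0_pi onem_st_itv). Qed.

Lemma is_derive_logB_t : is_derive t 1 (logB s) (dlogB s t).
Proof.
have h := is_derive_sub
  (is_derive_lnsin_comp sin_t_gt0 (is_derive_idR t))
  (is_derive_lnsin_comp sin_onem_st_gt0 (is_derive_mulc (1 - s) (is_derive_idR t))).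
by apply: (is_derive_eq h); rewrite !mul1r mulr1.
Qed.

Lemma is_derive_logz_t : is_derive t 1 (logz s) (dlogz s t).
Proof.
have h := is_derive_sub
  (is_derive_lnsin_comp sin_st_gt0 (is_derive_mulc s (is_derive_idR t)))
  (is_derive_lnsin_comp sin_onem_st_gt0 (is_derive_mulc (1 - s) (is_derive_idR t))).
by apply: (is_derive_eq h); rewrite !mulr1.
Qed.

Lemma is_derive_modBz_t m j : is_derive t 1 (modBz m j s)
  ((m * dlogB s t - j * dlogz s t) * modBz m j s t).
Proof.
exact: (is_derive_expR_comp (is_derive_sub
  (is_derive_mulc m is_derive_logB_t) (is_derive_mulc j is_derive_logz_t))).
Qed.

Lemma is_derive_ReBz_t m j : is_derive t 1 (ReBz m j s)
  ((m * dlogB s t - j * dlogz s t) * ReBz m j s t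
   - (m * s - j) * ImBz m j s t).
Proof.
have h := is_derive_mul (is_derive_modBz_t m j)
  (is_derive_cos_comp (is_derive_mulc (m * s - j) (is_derive_idR t))).
by apply: (is_derive_eq h); rewrite /ReBz /ImBz mulr1; ring.
Qed.

Lemma is_derive_ImBz_t m j : is_derive t 1 (ImBz m j s)
  ((m * dlogB s t - j * dlogz s t) * ImBz m j s t
   + (m * s - j) * ReBz m j s t).
Proof.
have h := is_derive_mul (is_derive_modBz_t m j)
  (is_derive_sin_comp (is_derive_mulc (m * s - j) (is_derive_idR t))).
by apply: (is_derive_eq h); rewrite /ReBz /ImBz mulr1; ring.
Qed.

Lemma sin_tE : sin t = sin (s * t) * cos ((1 - s) * t)
                       + cos (s * t) * sin ((1 - s) * t).
Proof. by rewrite -sinD -mulrDl addrC subrK mul1r. Qed.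

Lemma cos_tE : cos t = cos (s * t) * cos ((1 - s) * t)
                       - sin (s * t) * sin ((1 - s) * t).
Proof. by rewrite -cosD -mulrDl addrC subrK mul1r. Qed.

(* z' / B = (B - 1)' / B = B' / B *)
Lemma cform_pred m j : cform (m - 1) (j - 1) s t =
  s * ReBz m j s t + dlogB s t * ImBz m j s t.
Proof.
have a0 := sin_st_gt0; have b0 := sin_onem_st_gt0; have t0 := sin_t_gt0.
rewrite /cform /ReBz /ImBz.
(* [B^(m-1) z^(1-j)] is [B^m z^-j] times [z / B], of argument [(1 - s) t] and modulus
   [sin (s t) / sin t]. *)
have -> : ((m - 1) * s - (j - 1)) * t = (m * s - j) * t + (1 - s) * t by ring.
have -> : modBz (m - 1) (j - 1) s t =
    modBz m j s t * (sin (s * t) / sin t).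
  rewrite /modBz -[X in _ = _ * X]lnK; last by rewrite posrE divr_gt0.
  rewrite -expRD; congr expR.
  by rewrite ln_div ?posrE// /logB /logz; ring.
rewrite sinD cosD /dlogz /dlogB /cot.
move: (modBz _ _ _ _) (sin ((m * s - j) * t)) (cos ((m * s - j) * t)) => M y x.
have := cos2Dsin2 (s * t); have := cos2Dsin2 ((1 - s) * t).
move: t0 a0 b0; rewrite cos_tE sin_tE.
move: (sin (s * t)) (cos (s * t)) (sin ((1 - s) * t)) (cos ((1 - s) * t)).
move=> sa ca sb cb t0 a0 b0 hb ha.
have t0' := lt0r_neq0 t0; have a0' := lt0r_neq0 a0; have b0' := lt0r_neq0 b0.
field.
by rewrite t0' a0' b0'.
Qed.

(** The integration by parts formula: as [dB = dz], [d (B^m z^-j) = (m B^(m-1) z^(1-j) - j B^m z^-j)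
    dz / z]. *)
Lemma is_derive_ImBz_cform m j : is_derive t 1 (ImBz m j s)
  (m * cform (m - 1) (j - 1) s t - j * cform m j s t).
Proof.
apply: (is_derive_eq (is_derive_ImBz_t m j)).
by rewrite cform_pred /cform; ring.
Qed.

End pointwise.
End contour.

(** * Closedness of [Im (B^a dz / z)] in the variables [s] and [t] *)

Section homotopy.
Context {R : realType}.
Implicit Types (a s t : R).

Definition dlogz_ds s t : R :=
  cot (s * t) + cot ((1 - s) * t)
  - (s * t / sin (s * t) ^+ 2 + (1 - s) * t / sin ((1 - s) * t) ^+ 2).

(** Obtained from [B'_s / B = t cot ((1 - s) t) + i t]. *)
Definition dcform_ds a s t : R :=
  a * (t * cot ((1 - s) * t) * ReBz a 0 s t - t * ImBz a 0 s t)
  + a * dlogz s t * (t * cot ((1 - s) * t) * ImBz a 0 s t + t * ReBz a 0 s t)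
  + dlogz_ds s t * ImBz a 0 s t.

(** The [ds] component [Im (B^a z'_s / z)] of the form, with [z'_s / z = t (cot (s t) + cot ((1 - s)
    t))]. *)
Definition flux a s t : R :=
  ImBz a 0 s t * (t * (cot (s * t) + cot ((1 - s) * t))).

Variables s t : R.
Hypotheses (s01 : 0 < s < 1) (t0pi : 0 < t < pi).

Let sa0 : 0 < sin (s * t) := sin_st_gt0 s01 t0pi.
Let sb0 : 0 < sin ((1 - s) * t) := sin_onem_st_gt0 s01 t0pi.
Let st0 : 0 < sin t := sin_t_gt0 t0pi.

Let ds_st : is_derive s 1 (fun u => u * t) t.
Proof.
have h := is_derive_mul (is_derive_idR s) (is_derive_cstR t s).
by apply: (is_derive_eq h); rewrite mulr0 addr0 mul1r.
Qed.

Let ds_onem : is_derive s 1 (fun u => 1 - u) (-1).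
Proof.
have h := is_derive_sub (is_derive_cstR 1 s) (is_derive_idR s).
by apply: (is_derive_eq h); rewrite sub0r.
Qed.

Let ds_onem_st : is_derive s 1 (fun u => (1 - u) * t) (- t).
Proof.
have h := is_derive_mul ds_onem (is_derive_cstR t s).
by apply: (is_derive_eq h); rewrite mulr0 addr0 mulN1r.
Qed.

Let ds_dlogz : is_derive s 1 (dlogz ^~ t) (dlogz_ds s t).
Proof.
have h := is_derive_sub
  (is_derive_mul (is_derive_idR s) (@is_derive_cot_comp _ _ s _ (lt0r_neq0 sa0) ds_st))
  (is_derive_mul ds_onem (@is_derive_cot_comp _ _ s _ (lt0r_neq0 sb0) ds_onem_st)).
by apply: (is_derive_eq h); rewrite /dlogz_ds; ring.
Qed.

Let ds_logB : is_derive s 1 (logB ^~ t) (t * cot ((1 - s) * t)).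
Proof.
have h := is_derive_sub (is_derive_cstR (ln (sin t)) s)
  (@is_derive_lnsin_comp _ _ s _ sb0 ds_onem_st).
by apply: (is_derive_eq h); rewrite sub0r mulNr opprK.
Qed.

Let ds_modBz a : is_derive s 1 ((modBz a 0) ^~ t)
  (a * (t * cot ((1 - s) * t)) * modBz a 0 s t).
Proof.
rewrite (_ : (modBz a 0) ^~ t = fun u => expR (a * logB u t)); last first.
  by apply/funext => u; rewrite /modBz mul0r subr0.
have h := is_derive_expR_comp (is_derive_mulc a ds_logB).
by apply: (is_derive_eq h); rewrite /modBz mul0r subr0.
Qed.

Let ds_arg a : is_derive s 1 (fun u => (a * u - 0) * t) (a * t).
Proof.
rewrite (_ : (fun _ => _) = (fun u => (a * t) * u)); last first.
  by apply/funext => u; ring.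
by apply: (is_derive_eq (is_derive_mulc (a * t) (is_derive_idR s))); rewrite mulr1.
Qed.

Lemma is_derive_cform_s a :
  is_derive s 1 ((cform a 0) ^~ t) (dcform_ds a s t).
Proof.
have hR := is_derive_mul (ds_modBz a) (is_derive_cos_comp (ds_arg a)).
have hI := is_derive_mul (ds_modBz a) (is_derive_sin_comp (ds_arg a)).
have h := is_derive_add hR (is_derive_mul ds_dlogz hI).
by apply: (is_derive_eq h); rewrite /dcform_ds /ReBz /ImBz; ring.
Qed.

(* z'_s / z is real, so that the form Im (B^a dz / z) is closed. *)
Lemma is_derive_flux_t a : is_derive t 1 (flux a s) (dcform_ds a s t).
Proof.
have hV := is_derive_mul (is_derive_idR t) (is_derive_add
  (is_derive_cot_comp (lt0r_neq0 sa0) (is_derive_mulc s (is_derive_idR t)))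
  (is_derive_cot_comp (lt0r_neq0 sb0) (is_derive_mulc (1 - s) (is_derive_idR t)))).
have h := is_derive_mul (is_derive_ImBz_t s01 t0pi a 0) hV.
apply: (is_derive_eq h); rewrite /dcform_ds /dlogz_ds /dlogz /dlogB.
move: (ReBz _ _ _ _) (ImBz _ _ _ _) => x y.
rewrite /cot (cos_tE s t) (sin_tE s t).
have := cos2Dsin2 (s * t); have := cos2Dsin2 ((1 - s) * t).
have := st0; rewrite (sin_tE s t).
move: sa0 sb0.
move: (sin (s * t)) (cos (s * t)) (sin ((1 - s) * t)) (cos ((1 - s) * t)).
move=> sa ca sb cb a0 b0 t0 hb ha.
have t0' := lt0r_neq0 t0; have a0' := lt0r_neq0 a0; have b0' := lt0r_neq0 b0.
field.
by rewrite t0' a0' b0'.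
Qed.

End homotopy.

(** * Bounds *)

Section sin_bounds.
Context {R : realType}.
Implicit Types x y s t : R.

Lemma sin_le_id x : 0 <= x -> sin x <= x.
Proof.
move=> x0; have [c _] := @MVT_segment R sin cos 0 x x0 (fun y _ => is_derive_sin y)
  (continuous_subspaceT (@continuous_sin R)).
rewrite sin0 !subr0 => ->; rewrite -[leRHS]mul1r; apply: ler_wpM2r => //.
Qed.

Lemma norm_sin_le x : `|sin x| <= `|x|.
Proof.
wlog x0 : x / 0 <= x => [hw|].
  have [/hw//|/ltW x0] := leP 0 x.
  by rewrite -normrN -sinN -(normrN x); apply: hw; rewrite oppr_ge0.
rewrite (ger0_norm x0) ler_norml sin_le_id// andbT.
have [c _] := @MVT_segment R sin cos 0 x x0 (fun y _ => is_derive_sin y)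
  (continuous_subspaceT (@continuous_sin R)).
rewrite sin0 !subr0 => ->; rewrite -mulN1r; apply: ler_wpM2r => //.
exact: cos_geN1.
Qed.

(* The slope of sin on [0, x] is at least its slope on [x, y]. *)
Lemma sin_chord x y : 0 < x -> x <= y -> y <= pi -> x * sin y <= y * sin x.
Proof.
move=> x0 xy ypi.
have [c] := @MVT_segment R sin cos 0 x (ltW x0) (fun y _ => is_derive_sin y)
  (continuous_subspaceT (@continuous_sin R)).
rewrite in_itv/= => /andP[c0 cx]; rewrite sin0 !subr0 => sx.
have [d] := @MVT_segment R sin cos x y xy (fun y _ => is_derive_sin y)
  (continuous_subspaceT (@continuous_sin R)).
rewrite in_itv/= => /andP[xd dy] sy.
have cd : cos d <= cos c.
  have [->//|cd] := eqVneq c d.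
  have cd' : c < d by rewrite lt_neqAle cd (le_trans cx).
  by rewrite ltW// ltr_cos// in_itv/=; lra.
have -> : sin y = cos c * x + cos d * (y - x) by rewrite -sy -sx addrC subrK.
rewrite sx.
have : cos d * (y - x) <= cos c * (y - x) by rewrite ler_wpM2r// subr_ge0.
move=> h; have : x * (cos d * (y - x)) <= x * (cos c * (y - x)).
  by rewrite ler_wpM2l// ltW.
lra.
Qed.

(** Jordan's inequality, the case [y = pi / 2] of [sin_chord]. *)
Lemma sin_ge_linear x : 0 <= x -> x <= pi / 2 -> 2 / pi * x <= sin x.
Proof.
rewrite le_eqVlt => /predU1P[<-|x0] xpi; first by rewrite sin0 mulr0.
have pi0 := @pi_gt0 R.
have := sin_chord x0 xpi; rewrite sin_pihalf mulr1 => /(_ _) h.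
rewrite mulrAC ler_pdivrMr// mulrC.
have : x <= pi / 2 * sin x by apply: h; lra.
lra.
Qed.

Lemma sin_linear_lb s1 s2 : 0 < s1 -> s1 <= s2 -> s2 < 1 ->
  exists2 k, 0 < k & forall s t, s1 <= s <= s2 -> 0 < t < pi ->
    k * t <= sin (s * t).
Proof.
move=> s10 s12 s21; have pi0 := @pi_gt0 R.
have s20 : 0 < s2 by lra.
have s2pi : 0 < s2 * pi < pi by rewrite mulr_gt0//= gtr_pMl.
have k0 := sin_gt0_pi s2pi.
(* The slope of the chord of [sin] from 0 to the largest argument [s2 * pi], times the least value
   of [s]. *)
exists (s1 * (sin (s2 * pi) / (s2 * pi))).
  by rewrite !mulr_gt0// invr_gt0; case/andP: s2pi.
move=> s t /andP[s1s ss2] /andP[t0 tpi].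
have s0 : 0 < s by lra.
have st2 : s * t <= s2 * pi.
  by apply: ler_pM => //; exact: ltW.
have := @sin_chord (s * t) (s2 * pi) (mulr_gt0 s0 t0) st2.
case/andP: s2pi => h1 h2 /(_ (ltW h2)) h.
apply: (@le_trans _ _ (s * t * (sin (s2 * pi) / (s2 * pi)))).
  rewrite mulrAC; apply: ler_wpM2r; first by rewrite ltW// divr_gt0.
  by rewrite ler_pM2r.
by rewrite mulrA ler_pdivrMr// [leRHS]mulrC.
Qed.

End sin_bounds.

Section contour_bounds.
Context {R : realType}.
Implicit Types (m j s t k : R).

(** [k] is uniform in [s] because differentiation under the integral needs one dominating function
    near [s]; with [s1 = s2] it serves a single [s]. *)
Lemma sin_sub_lb s1 s2 : 0 < s1 -> s1 <= s2 -> s2 < 1 ->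
  exists2 k, 0 < k & forall s t, s1 <= s <= s2 -> 0 < t < pi ->
    k * t <= sin (s * t) /\ k * t <= sin ((1 - s) * t).
Proof.
move=> s10 s12 s21.
have [k1 k10 h1] := sin_linear_lb s10 s12 s21.
have [k2 k20 h2] : exists2 k, 0 < k & forall s t, 1 - s2 <= s <= 1 - s1 ->
    0 < t < pi -> k * t <= sin (s * t).
  by apply: sin_linear_lb; lra.
exists (Num.min k1 k2); first by rewrite lt_min k10.
move=> s t ss tt; have t0 : 0 <= t by case/andP: tt => /ltW.
split.
  apply: le_trans (h1 _ _ ss tt); apply: ler_wpM2r => //.
  by rewrite ge_min lexx.
apply: le_trans (h2 (1 - s) _ _ tt); last by lra.
by apply: ler_wpM2r => //; rewrite ge_min lexx orbT.
Qed.

Variables s t k : R.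
Hypotheses (s01 : 0 < s < 1) (t0pi : 0 < t < pi) (k0 : 0 < k).
Hypotheses (ka : k * t <= sin (s * t)) (kb : k * t <= sin ((1 - s) * t)).

Let t0 : 0 < t. Proof. by case/andP: t0pi. Qed.
Let kt0 : 0 < k * t. Proof. exact: mulr_gt0. Qed.
Let sa0 : 0 < sin (s * t) := sin_st_gt0 s01 t0pi.
Let sb0 : 0 < sin ((1 - s) * t) := sin_onem_st_gt0 s01 t0pi.
Let st0 : 0 < sin t := sin_t_gt0 t0pi.

Lemma cot_bound (x : R) : k * t <= sin x -> `|cot x| <= (k * t)^-1.
Proof.
move=> h; have sx := lt_le_trans kt0 h.
rewrite /cot normrM normfV (gtr0_norm sx) -[leRHS]mul1r.
apply: ler_pM; rewrite ?cos_max ?lef_pV2 ?posrE//.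
by rewrite invr_ge0 ltW.
Qed.

Let le_ln (x y : R) : 0 < x -> x <= y -> ln x <= ln y.
Proof.
by move=> x0 xy; rewrite ler_ln// posrE (lt_le_trans x0).
Qed.

Let sinb_le : sin ((1 - s) * t) <= t.
Proof.
case/andP: s01 => h1 h2.
apply: le_trans (sin_le_id _) _; first by rewrite mulr_ge0 ?(ltW t0)//; lra.
by rewrite ger_pMl//; lra.
Qed.

Let logz_ge : ln k <= logz s t.
Proof.
rewrite /logz -ln_div ?posrE//; apply: le_ln => //.
rewrite ler_pdivlMr//; apply: le_trans ka.
by rewrite ler_pM2l.
Qed.

(** By the bounds on the sines, [|B| <= 1 / k] and [|z| >= k]. *)
Lemma modBz_le m j : 0 <= m -> 0 <= j ->
  modBz m j s t <= expR (- (m + j) * ln k).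
Proof.
move=> m0 j0; rewrite /modBz ler_expR.
have hB : logB s t <= - ln k.
  rewrite /logB; have : ln (k * sin t) <= ln (sin ((1 - s) * t)).
    apply: le_ln; first by rewrite mulr_gt0.
    by apply: le_trans kb; rewrite ler_pM2l// sin_le_id// ltW.
  rewrite lnM ?posrE//; lra.
have h1 : m * logB s t <= m * - ln k by rewrite ler_wpM2l.
have h2 : j * ln k <= j * logz s t by rewrite ler_wpM2l.
lra.
Qed.

(** Unlike [modBz_le], this keeps the factor [sin t ^ m], which kills the boundary terms at [pi],
    where [B] tends to 0. *)
Lemma modBz_le_powR m j : 0 <= m -> 0 <= j ->
  modBz m j s t <= sin t `^ m * expR (- m * ln (k * t) - j * ln k).
Proof.
move=> m0 j0; rewrite /powR (gt_eqF st0) -expRD ler_expR /logB.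
have h1 : m * ln (k * t) <= m * ln (sin ((1 - s) * t)).
  by rewrite ler_wpM2l// le_ln.
have h2 : j * ln k <= j * logz s t by rewrite ler_wpM2l.
lra.
Qed.

Lemma modBz_ge0 m j : 0 <= modBz m j s t. Proof. exact: expR_ge0. Qed.

Lemma ReBz_le m j : `|ReBz m j s t| <= modBz m j s t.
Proof.
rewrite normrM ger0_norm ?modBz_ge0// ler_piMr ?modBz_ge0//.
exact: cos_max.
Qed.

Lemma ImBz_le m j : `|ImBz m j s t| <= modBz m j s t.
Proof.
rewrite normrM ger0_norm ?modBz_ge0// ler_piMr ?modBz_ge0//.
exact: sin_max.
Qed.

(** The argument of [B^m z^-j] is proportional to [t]. This compensates the singularity [1 / t] of
    [dlogz] and [dlogz_ds], and gives the boundary values at 0. *)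
Lemma ImBz_le_t m j :
  `|ImBz m j s t| <= modBz m j s t * (`|m * s - j| * t).
Proof.
rewrite normrM ger0_norm ?modBz_ge0// ler_wpM2l ?modBz_ge0//.
by apply: le_trans (norm_sin_le _) _; rewrite normrM (gtr0_norm t0).
Qed.

Lemma dlogz_bound : `|dlogz s t| <= (k * t)^-1.
Proof.
have ha := cot_bound ka; have hb := cot_bound kb; case/andP: s01 => h0 h1.
apply: le_trans (ler_normB _ _) _.
rewrite (normrM s) (normrM (1 - s)) (gtr0_norm h0).
rewrite (@gtr0_norm _ (1 - s)) ?subr_gt0//.
have e1 : s * `|cot (s * t)| <= s * (k * t)^-1 by rewrite ler_pM2l.
have e2 : (1 - s) * `|cot ((1 - s) * t)| <= (1 - s) * (k * t)^-1.
  by rewrite ler_pM2l// subr_gt0.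
move: (k * t)^-1 e1 e2 => K e1 e2; lra.
Qed.

Lemma cform_bound m j : 0 <= m -> 0 <= j ->
  `|cform m j s t| <= expR (- (m + j) * ln k) * (1 + `|m * s - j| / k).
Proof.
move=> m0 j0; have hM := modBz_le m0 j0.
apply: le_trans (ler_normD _ _) _; rewrite mulrDr mulr1; apply: lerD.
  exact: le_trans (ReBz_le _ _) hM.
rewrite normrM.
apply: (@le_trans _ _ ((k * t)^-1 * (expR (- (m + j) * ln k) * (`|m * s - j| * t)))).
  apply: ler_pM => //; first exact: dlogz_bound.
  apply: le_trans (ImBz_le_t _ _) _; apply: ler_wpM2r => //.
  by rewrite mulr_ge0// ltW.
rewrite le_eqVlt; apply/orP; left; apply/eqP; field.
by rewrite (lt0r_neq0 t0) (lt0r_neq0 k0).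
Qed.

Lemma flux_bound a : 0 <= a ->
  `|flux a s t| <= modBz a 0 s t * (`|a * s| * t) * (2 / k).
Proof.
move=> a0; rewrite /flux normrM; apply: ler_pM => //.
  by have := ImBz_le_t a 0; rewrite subr0.
rewrite normrM (gtr0_norm t0).
have := ler_normD (cot (s * t)) (cot ((1 - s) * t)).
have := cot_bound ka; have := cot_bound kb => h1 h2 h3.
apply: (@le_trans _ _ (t * (2 * (k * t)^-1))).
  rewrite ler_pM2l//; lra.
rewrite le_eqVlt; apply/orP; left; apply/eqP; field.
by rewrite (lt0r_neq0 t0) (lt0r_neq0 k0).
Qed.

Lemma dlogz_ds_bound : `|dlogz_ds s t| <= (2 / k + (k ^+ 2)^-1) / t.
Proof.
case/andP: s01 => h0 h1; rewrite /dlogz_ds.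
have hq x c : 0 <= c -> k * t <= sin x -> `|c * t / sin x ^+ 2| <= c * (t / (k * t) ^+ 2).
  move=> c0 hx; have sx := lt_le_trans kt0 hx.
  rewrite ger0_norm; last by rewrite divr_ge0 ?sqr_ge0// mulr_ge0// ltW.
  rewrite -mulrA ler_wpM2l// ler_pM2l// lef_pV2 ?posrE ?exprn_gt0//.
  by rewrite ler_pXn2r ?nnegrE// ltW.
have := hq (s * t) s (ltW h0) ka.
have := hq ((1 - s) * t) (1 - s) _ kb; rewrite subr_ge0 => /(_ (ltW h1)).
have := ler_normD (cot (s * t)) (cot ((1 - s) * t)).
have := ler_normB (cot (s * t) + cot ((1 - s) * t))
  (s * t / sin (s * t) ^+ 2 + (1 - s) * t / sin ((1 - s) * t) ^+ 2).
have := ler_normD (s * t / sin (s * t) ^+ 2)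
  ((1 - s) * t / sin ((1 - s) * t) ^+ 2).
have := cot_bound ka; have := cot_bound kb.
have -> : (2 / k + (k ^+ 2)^-1) / t = 2 * (k * t)^-1 + t / (k * t) ^+ 2.
  field; by rewrite (lt0r_neq0 t0) (lt0r_neq0 k0).
move: (_^-1) (t / (k * t) ^+ 2) => K L; lra.
Qed.

(** Every factor of order [1 / t] meets a factor [t], either explicit or coming from [Im B^a]. What
    remains depends on [a] and [k] only, hence dominates for all [s] sharing the same [k]. *)
Lemma dcform_ds_bound a : 0 <= a ->
  `|dcform_ds a s t| <= expR (- a * ln k) *
    (a * (k^-1 + pi) + a / k * (a / k + 1) + (2 / k + (k ^+ 2)^-1) * a).
Proof.
move=> a0; case/andP: s01 => h0 h1; case/andP: t0pi => _ tpi.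
have := modBz_le a0 (lexx 0); rewrite addr0.
set M := expR _ => hM.
have M0 : 0 <= M by exact: expR_ge0.
have hX : `|ReBz a 0 s t| <= M by exact: le_trans (ReBz_le _ _) hM.
have hY : `|ImBz a 0 s t| <= M by exact: le_trans (ImBz_le _ _) hM.
have hYt : `|ImBz a 0 s t| <= M * (a * t).
  apply: le_trans (ImBz_le_t _ _) _; apply: ler_pM => //.
  - exact: modBz_ge0.
  - by rewrite mulr_ge0// ltW.
  - apply: ler_wpM2r; first exact: ltW.
    by rewrite subr0 ger0_norm ?mulr_ge0 ?(ltW h0)// ler_piMr// ltW.
have hmu : `|t * cot ((1 - s) * t)| <= k^-1.
  rewrite (normrM t) (gtr0_norm t0); have := cot_bound kb => h.
  apply: (@le_trans _ _ (t * (k * t)^-1)); first by rewrite ler_pM2l.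
  by rewrite invfM mulrCA mulfV ?mulr1// lt0r_neq0.
have k1 : 0 <= k^-1 by rewrite invr_ge0 ltW.
have k2 : 0 <= 2 / k + (k ^+ 2)^-1.
  by rewrite addr_ge0 ?mulr_ge0 ?invr_ge0 ?exprn_ge0 ?(ltW k0).
rewrite /dcform_ds; apply: le_trans (ler_normD _ _) _.
rewrite [leRHS]mulrDr; apply: lerD.
  apply: le_trans (ler_normD _ _) _; rewrite [leRHS]mulrDr; apply: lerD.
    rewrite (normrM a) (ger0_norm a0) [leRHS]mulrCA ler_wpM2l//.
    apply: le_trans (ler_normB _ _) _; rewrite [leRHS]mulrDr; apply: lerD.
      by rewrite (normrM (t * _)) mulrC; apply: ler_pM.
    by rewrite (normrM t) (gtr0_norm t0) mulrC; apply: ler_pM => //; exact: ltW.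
  rewrite (normrM (a * _)) (normrM a) (ger0_norm a0).
  have -> : M * (a / k * (a / k + 1)) =
      a * (k * t)^-1 * (k^-1 * (M * (a * t)) + t * M).
    by field; rewrite (lt0r_neq0 t0) (lt0r_neq0 k0).
  apply: ler_pM => //; first by rewrite mulr_ge0.
    by rewrite ler_wpM2l// dlogz_bound.
  apply: le_trans (ler_normD _ _) _; apply: lerD.
    by rewrite (normrM (t * _)); apply: ler_pM.
  by rewrite (normrM t) (gtr0_norm t0) ler_pM2l.
rewrite (normrM (dlogz_ds _ _)).
have -> : M * ((2 / k + (k ^+ 2)^-1) * a) =
    (2 / k + (k ^+ 2)^-1) / t * (M * (a * t)).
  by field; rewrite (lt0r_neq0 t0) (lt0r_neq0 k0).
by apply: ler_pM => //; exact: dlogz_ds_bound.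
Qed.

End contour_bounds.

(** * Contour integrals *)

Section contour_integral.
Context {R : realType}.
Implicit Types (m j a s t : R).
Notation mu := (@lebesgue_measure R).
Local Notation D := (`]0, pi[%classic : set R).

Lemma is_derive_continuous (f : R -> R) (x df : R) :
  is_derive x 1 f df -> {for x, continuous f}.
Proof.
move=> [fx _]; apply: differentiable_continuous.
exact/derivable1_diffP.
Qed.

Lemma continuous_cform m j s t : 0 < s < 1 -> 0 < t < pi ->
  {for t, continuous (cform m j s)}.
Proof.
move=> s01 t0pi.
have sa0 := lt0r_neq0 (sin_st_gt0 s01 t0pi).
have sb0 := lt0r_neq0 (sin_onem_st_gt0 s01 t0pi).
have hT c (h : sin (c * t) != 0) := is_derive_mulc c (is_derive_cot_comp h
  (is_derive_mulc c (is_derive_idR t))).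
apply: is_derive_continuous.
exact: (is_derive_add (is_derive_ReBz_t s01 t0pi m j)
  (is_derive_mul (is_derive_sub (hT _ sa0) (hT _ sb0))
    (is_derive_ImBz_t s01 t0pi m j))).
Qed.

Lemma continuous_dcform_ds a s t : 0 < s < 1 -> 0 < t < pi ->
  {for t, continuous (dcform_ds a s)}.
Proof.
move=> s01 t0pi.
have sa0 := lt0r_neq0 (sin_st_gt0 s01 t0pi).
have sb0 := lt0r_neq0 (sin_onem_st_gt0 s01 t0pi).
have hid := is_derive_idR t.
have hlin c := is_derive_mulc c hid.
have hcot c (h : sin (c * t) != 0) := is_derive_cot_comp h (hlin c).
have hs c := is_derive_sin_comp (hlin c).
(* The square is written as a product, to which [_ ^+ 2] unfolds, so that the product rule
   applies. *)
have hsq c (h : sin (c * t) != 0) := is_derive_mul (hlin c)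
  (@is_derive_inv_comp _ (fun y => sin (c * y) * sin (c * y)) t _
    (mulf_neq0 h h) (is_derive_mul (hs c) (hs c))).
have hX := is_derive_ReBz_t s01 t0pi a 0.
have hY := is_derive_ImBz_t s01 t0pi a 0.
have hmu := is_derive_mul hid (hcot _ sb0).
have hT := is_derive_sub (is_derive_mulc s (hcot _ sa0))
  (is_derive_mulc (1 - s) (hcot _ sb0)).
have hTs := is_derive_sub (is_derive_add (hcot _ sa0) (hcot _ sb0))
  (is_derive_add (hsq _ sa0) (hsq _ sb0)).
have h1 := is_derive_mulc a (is_derive_sub (is_derive_mul hmu hX)
  (is_derive_mul hid hY)).
have h2 := is_derive_mul (is_derive_mulc a hT)
  (is_derive_add (is_derive_mul hmu hY) (is_derive_mul hid hX)).
have h3 := is_derive_mul hTs hY.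
exact: (is_derive_continuous (is_derive_add (is_derive_add h1 h2) h3)).
Qed.

Lemma itv0pi t : t \in `]0, pi[ -> 0 < t < pi. Proof. by rewrite in_itv. Qed.

Lemma lebesgue_measure_0pi : mu D = (pi : R)%:E.
Proof. by rewrite lebesgue_measure_itv/= lte_fin pi_gt0 oppr0 adde0. Qed.

Lemma integrable_bounded_continuous_0pi (f : R -> R) (C : R) :
  (forall t, 0 < t < pi -> `|f t| <= C) ->
  (forall t, 0 < t < pi -> {for t, continuous f}) ->
  mu.-integrable D (EFin \o f).
Proof.
move=> fC cf; apply: measurable_bounded_integrable.
- exact: measurable_itv.
- by rewrite [ltLHS]lebesgue_measure_0pi ltry.
- apply: open_continuous_measurable_fun; first exact: itv_open.
  by move=> t; rewrite inE/= => /itv0pi; exact: cf.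
- exists C; split; first exact: num_real.
  move=> M CM t /= /itv0pi h; exact: le_trans (fC _ h) (ltW CM).
Qed.

Section fixed_s.
Variable s : R.
Hypothesis s01 : 0 < s < 1.

Let ks : exists2 k, 0 < k & forall t, 0 < t < pi ->
  k * t <= sin (s * t) /\ k * t <= sin ((1 - s) * t).
Proof.
case/andP: s01 => s0 s1; have [k k0 h] := sin_sub_lb s0 (lexx s) s1.
by exists k => // t tt; apply: h => //; rewrite lexx.
Qed.

Lemma cform_bounded m j : 0 <= m -> 0 <= j ->
  exists2 C, 0 <= C & forall t, 0 < t < pi -> `|cform m j s t| <= C.
Proof.
move=> m0 j0; have [k k0 h] := ks.
exists (expR (- (m + j) * ln k) * (1 + `|m * s - j| / k)).
  by rewrite mulr_ge0 ?expR_ge0// addr_ge0// divr_ge0// ltW.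
by move=> t tt; have [ha hb] := h t tt; exact: cform_bound.
Qed.

Lemma integrable_cform m j : 0 <= m -> 0 <= j ->
  mu.-integrable D (EFin \o cform m j s).
Proof.
move=> m0 j0; have [C _ h] := cform_bounded m0 j0.
by apply: integrable_bounded_continuous_0pi h _ => t; exact: continuous_cform.
Qed.

Let near0 : \forall t \near (0 : R)^'+, 0 < t < pi.
Proof.
near=> t; apply/andP; split; first by near: t; exact: nbhs_right_gt.
by near: t; apply: nbhs_right_lt; exact: pi_gt0.
Unshelve. all: by end_near. Qed.

(** The cutoff 1 keeps [t] away from 0, so that [ln (k * t) >= ln k] in [modBz_le_near_pi]. *)
Let nearpi : \forall t \near (pi : R)^'-, 1 < t < pi.
Proof.
near=> t; apply/andP; split; last by near: t; exact: nbhs_left_lt.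
near: t; apply: nbhs_left_gt; have := @pi_ge2 R; lra.
Unshelve. all: by end_near. Qed.

Let cvg_at0 (f : R -> R) C : (forall t, 0 < t < pi -> `|f t| <= C * t) ->
  f t @[t --> 0^'+] --> 0.
Proof.
move=> fC; apply: norm_cvg0.
have h : C * t @[t --> 0^'+] --> (0 : R).
  rewrite -[X in _ --> X](mulr0 C); apply: cvgM; first exact: cvg_cst.
  by apply: cvg_at_right_filter; exact: cvg_id.
apply: (squeeze_cvgr _ (cvg_cst 0) h).
near=> t; rewrite normr_ge0/=; apply: fC; near: t; exact: near0.
Unshelve. all: by end_near. Qed.

Let cvg_atpi (f : R -> R) m C : 0 < m ->
  (forall t, 1 < t < pi -> `|f t| <= sin t `^ m * C) ->
  f t @[t --> pi^'-] --> 0.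
Proof.
move=> m0 fC; apply: norm_cvg0.
have hsin : sin t @[t --> pi^'-] --> (0 : R)^'+.
  have sin_pi : sin t @[t --> pi^'-] --> (0 : R).
    rewrite -[X in _ --> X](@sinpi R); apply: cvg_at_left_filter.
    exact: continuous_sin.
  move=> A hA; have hA' := sin_pi _ hA.
  change (\forall t \near (pi : R)^'-, A (sin t)).
  near=> t; have : 0 < sin t -> A (sin t) by near: t; exact: hA'.
  apply; apply: sin_gt0_pi.
  have : 1 < t < pi by near: t; exact: nearpi.
  lra.
have h : sin t `^ m * C @[t --> pi^'-] --> (0 : R).
  rewrite -[X in _ --> X](mul0r C); apply: cvgM; last exact: cvg_cst.
  exact: cvg_comp hsin (powR_cvg0 m0).
apply: (squeeze_cvgr _ (cvg_cst 0) h).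
near=> t; rewrite normr_ge0/=; apply: fC; near: t; exact: nearpi.
Unshelve. all: by end_near. Qed.

Lemma ImBz_cvg0 m j : 0 <= m -> 0 <= j -> ImBz m j s t @[t --> 0^'+] --> 0.
Proof.
move=> m0 j0; have [k k0 h] := ks.
apply: (@cvg_at0 _ (expR (- (m + j) * ln k) * `|m * s - j|)) => t tt.
have [ha hb] := h t tt; rewrite -mulrA.
apply: le_trans (ImBz_le_t _ tt _ _) _; rewrite ler_wpM2r//.
  by rewrite mulr_ge0//; case/andP: tt => /ltW.
exact: modBz_le.
Qed.

Let modBz_le_near_pi m j : 0 <= m -> 0 <= j ->
  exists2 C, 0 <= C & forall t, 1 < t < pi -> modBz m j s t <= sin t `^ m * C.
Proof.
move=> m0 j0; have [k k0 h] := ks.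
exists (expR (- m * ln k - j * ln k)) => [|t t1]; first exact: expR_ge0.
have tt : 0 < t < pi by lra.
have [ha hb] := h t tt.
apply: le_trans (modBz_le_powR s01 tt k0 ha hb m0 j0) _.
rewrite ler_wpM2l ?powR_ge0// ler_expR lerD2r !mulNr lerN2 ler_wpM2l//.
have h1 : 1 <= t by case/andP: t1 => /ltW.
rewrite ler_ln ?posrE// ?mulr_gt0//; last by lra.
by rewrite ler_pMr.
Qed.

Lemma ImBz_cvgpi m j : 0 < m -> 0 <= j -> ImBz m j s t @[t --> pi^'-] --> 0.
Proof.
move=> m0 j0; have [C C0 h] := modBz_le_near_pi (ltW m0) j0.
apply: (@cvg_atpi _ m C m0) => t tt.
by apply: (le_trans _ (h _ tt)); exact: ImBz_le.
Qed.

Lemma flux_cvg0 a : 0 <= a -> flux a s t @[t --> 0^'+] --> 0.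
Proof.
move=> a0; have [k k0 h] := ks.
apply: (@cvg_at0 _ (expR (- (a + 0) * ln k) * `|a * s| * (2 / k))) => t tt.
have [ha hb] := h t tt.
apply: le_trans (flux_bound tt k0 ha hb a0) _.
rewrite [leRHS]mulrAC; apply: ler_wpM2r; first by rewrite divr_ge0// ltW.
rewrite -mulrA; apply: ler_wpM2r.
  by rewrite mulr_ge0//; case/andP: tt => /ltW.
exact: modBz_le.
Qed.

Lemma flux_cvgpi a : 0 < a -> flux a s t @[t --> pi^'-] --> 0.
Proof.
move=> a0; have [k k0 h] := ks.
have [C C0 hC] := modBz_le_near_pi (ltW a0) (lexx 0).
apply: (@cvg_atpi _ a (C * (`|a * s| * pi) * (2 / k)) a0) => t t1.
have tt : 0 < t < pi by lra.
have [ha hb] := h t tt.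
apply: le_trans (flux_bound tt k0 ha hb (ltW a0)) _.
rewrite [leRHS]mulrA; apply: ler_wpM2r; first by rewrite divr_ge0// ltW.
rewrite [leRHS]mulrA; apply: ler_pM.
- exact: modBz_ge0.
- by rewrite mulr_ge0//; case/andP: tt => /ltW.
- exact: hC.
- by apply: ler_wpM2l => //; case/andP: tt => _ /ltW.
Qed.

Definition cint m j := \int[mu]_(t in D) cform m j s t.

(** Integrate [is_derive_ImBz_cform]. The boundary term vanishes at 0 with the argument, and at [pi]
    because [B] tends to 0 there and [m > 0]; [1 < m] and [1 <= j] keep the lowered exponents
    nonnegative, so both integrands are bounded. *)
Lemma cint_rec m j : 1 < m -> 1 <= j -> j * cint m j = m * cint (m - 1) (j - 1).
Proof.
move=> m1 j1.
have m0 : 0 <= m by lra.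
have j0 : 0 <= j by lra.
have m10 : 0 <= m - 1 by lra.
have j10 : 0 <= j - 1 by lra.
have i1 := integrable_cform m0 j0.
have i2 := integrable_cform m10 j10.
have [C C0 hC] := cform_bounded m0 j0.
have [C' C'0 hC'] := cform_bounded m10 j10.
have mD : measurable D by exact: measurable_itv.
have iZ c f : mu.-integrable D (EFin \o f) ->
    mu.-integrable D (EFin \o (fun t => c * f t)).
  by move=> i; exact: (@integrableZl _ _ _ mu D mD c (EFin \o f)).
have [_] : mu.-integrable D (EFin \o (fun t => m * cform (m - 1) (j - 1) s t - j * cform m j s t))
    /\ \int[mu]_(t in D) (m * cform (m - 1) (j - 1) s t - j * cform m j s t) = 0.
  apply: (@FTC_oo_vanish R _ (ImBz m j s) 0 pi (m * C' + j * C) (pi_gt0 R)).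
  - move=> t /itv0pi tt; have := hC t tt; have := hC' t tt.
    rewrite !ler_norml => /andP[h1 h2] /andP[h3 h4].
    have : j * cform m j s t <= j * C by rewrite ler_wpM2l.
    have : m * (- C') <= m * cform (m - 1) (j - 1) s t by rewrite ler_wpM2l.
    lra.
  - move=> t /itv0pi tt; apply: cvgB; apply: cvgM; try exact: cvg_cst;
      exact: continuous_cform.
  - by move=> t /itv0pi tt; exact: is_derive_ImBz_cform.
  - exact: ImBz_cvg0.
  - by apply: ImBz_cvgpi => //; lra.
rewrite RintegralB//; [|exact: iZ|exact: iZ].
rewrite RintegralZl// RintegralZl// => /eqP; rewrite subr_eq0 => /eqP.
by rewrite /cint => ->.
Qed.

End fixed_s.
End contour_integral.

(** * The integral of [Im (B^a dz / z)]: independence of [s], and its value *)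

Section residue.
Context {R : realType}.
Implicit Types (m j a s t : R).
Notation mu := (@lebesgue_measure R).
Local Notation D := (`]0, pi[%classic : set R).

(** The integrand is the [t]-derivative of [flux], which vanishes at both ends; at [pi] this uses
    [a > 0]. *)
Lemma integral_dcform_ds a s : 0 < a -> 0 < s < 1 ->
  \int[mu]_(t in D) dcform_ds a s t = 0.
Proof.
move=> a0 s01; have [s0 s1] := andP s01.
have [k k0 h] := sin_sub_lb s0 (lexx s) s1.
have hk t : 0 < t < pi -> k * t <= sin (s * t) /\ k * t <= sin ((1 - s) * t).
  by move=> tt; apply: h => //; rewrite lexx.
set C := expR (- a * ln k) *
  (a * (k^-1 + pi) + a / k * (a / k + 1) + (2 / k + (k ^+ 2)^-1) * a).
have [] // := @FTC_oo_vanish R (dcform_ds a s) (flux a s) 0 pi C (pi_gt0 R).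
- move=> t /itv0pi tt; have [ha hb] := hk t tt.
  have := dcform_ds_bound s01 tt k0 ha hb (ltW a0).
  by rewrite ler_norml => /andP[].
- by move=> t /itv0pi; exact: continuous_dcform_ds.
- by move=> t /itv0pi tt; exact: is_derive_flux_t.
- exact: flux_cvg0 (ltW a0).
- exact: flux_cvgpi.
Qed.

Lemma is_derive_cint a s : 0 < a -> 0 < s < 1 ->
  is_derive s 1 (fun s => cint s a 0) 0.
Proof.
move=> a0 s01; have [s0 s1] := andP s01.
(* [[u, v]] is a neighbourhood of [s] inside []0, 1[], on which a single [k], hence a single bound
   [C], serves. *)
pose u := s / 2; pose v := (1 + s) / 2.
have sub x : `]u, v[%classic x -> 0 < x < 1.
  by rewrite /= in_itv/= /u /v; lra.
have [k k0 hk] : exists2 k, 0 < k & forall x t, u <= x <= v -> 0 < t < pi ->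
    k * t <= sin (x * t) /\ k * t <= sin ((1 - x) * t).
  by apply: sin_sub_lb; rewrite /u /v; lra.
set C := expR (- a * ln k) *
  (a * (k^-1 + pi) + a / k * (a / k + 1) + (2 / k + (k ^+ 2)^-1) * a).
have C0 : 0 <= C.
  have h1 : 0 <= k^-1 by rewrite invr_ge0 ltW.
  have h2 : 0 <= a / k by rewrite mulr_ge0// ltW.
  have h3 : 0 <= (k ^+ 2)^-1 by rewrite invr_ge0 exprn_ge0// ltW.
  have a0' := ltW a0; have pi0 := @pi_ge0 R.
  rewrite /C mulr_ge0 ?expR_ge0// addr_ge0//; last first.
    by rewrite mulr_ge0// addr_ge0// mulr_ge0.
  by rewrite addr_ge0// mulr_ge0// addr_ge0.
have mD : measurable D by exact: measurable_itv.
have Is : `]u, v[%classic s by rewrite /= in_itv/= /u /v; lra.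
have intf x : `]u, v[%classic x -> mu.-integrable D (EFin \o cform a 0 x).
  by move/sub => x01; apply: integrable_cform => //; exact: ltW.
have derf x t : `]u, v[%classic x -> D t ->
    is_derive x 1 ((cform a 0) ^~ t) (dcform_ds a x t).
  by move=> /sub x01 /itv0pi tt; exact: is_derive_cform_s.
have derf1 x t : `]u, v[%classic x -> D t -> derivable ((cform a 0) ^~ t) x 1.
  by move=> xI tD; have h := derf x t xI tD; exact: ex_derive.
have p1 x t : `]u, v[%classic x -> D t ->
    partial1of2 (cform a 0) x t = dcform_ds a x t.
  by move=> xI tD; have h := derf x t xI tD; rewrite partial1of2E derive_val.
have intG : mu.-integrable D (EFin \o cst C).
  apply: (@integrable_bounded_continuous_0pi R (cst C) C).
    by move=> t _; rewrite /cst (ger0_norm C0).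
  by move=> t _; exact: cvg_cst.
have G_ub x t : `]u, v[%classic x -> D t ->
    `|partial1of2 (cform a 0) x t| <= cst C t.
  move=> xI tD; rewrite p1// /cst; have tt := itv0pi tD.
  have [ha hb] : k * t <= sin (x * t) /\ k * t <= sin ((1 - x) * t).
    apply: hk => //; move: xI; rewrite /= in_itv/=; lra.
  exact: (dcform_ds_bound (sub _ xI) tt k0 ha hb (ltW a0)).
have dF := @derivable_under_integral R _ (measurableTypeR R) mu (cform a 0) D mD s u v
  Is intf derf1 (cst C) (fun=> C0) intG G_ub.
have eF := @differentiation_under_integral R _ (measurableTypeR R) mu (cform a 0) D mD s u v
  Is intf derf1 (cst C) (fun=> C0) intG G_ub.
apply: DeriveDef; first exact: dF.
rewrite -derive1E [LHS]eF -[RHS](integral_dcform_ds a0 s01).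
by apply: eq_Rintegral => t /set_mem tD; rewrite p1.
Qed.

Lemma cint_const a s1 s2 : 0 < a -> 0 < s1 -> s1 <= s2 -> s2 < 1 ->
  cint s1 a 0 = cint s2 a 0.
Proof.
move=> a0 s10 s12 s21.
have dF x : s1 <= x <= s2 -> is_derive x 1 (fun s => cint s a 0) 0.
  by move=> xI; apply: is_derive_cint => //; lra.
have [] := @MVT_segment R (fun s => cint s a 0) (cst 0) s1 s2 s12.
- by move=> x; rewrite in_itv/= => xI; apply: dF; lra.
- apply: derivable_within_continuous => x; rewrite in_itv/= => xI.
  by have h := dF x xI; exact: ex_derive.
- by move=> c _ /=; rewrite mul0r => /eqP; rewrite subr_eq0 => /eqP.
Qed.

(** * Estimates uniform as [s] tends to 0 *)

Section small_s.
Variable t : R.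
Hypothesis t0pi : 0 < t < pi.
Let t0 : 0 < t. Proof. by case/andP: t0pi. Qed.
Let tpi : t < pi. Proof. by case/andP: t0pi. Qed.

Lemma st_le_sin s : 0 < s -> s <= 1 / 2 -> 2 / pi * (s * t) <= sin (s * t).
Proof.
move=> s0 s2; apply: sin_ge_linear; first by rewrite mulr_ge0// ltW.
apply: (@le_trans _ _ (1 / 2 * t)); first by rewrite ler_pM2r.
move: (@pi_gt0 R) tpi; lra.
Qed.

(** [(1 - s) * t] may exceed [pi / 2], beyond the range of [sin_ge_linear]; this comparison
    transfers the lower bound for [sin (s * t)] to it. *)
Lemma sin_st_le_onem s : 0 < s -> s <= 1 / 2 ->
  sin (s * t) <= sin ((1 - s) * t).
Proof.
move=> s0 s2.
rewrite -subr_ge0.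
have -> : sin ((1 - s) * t) - sin (s * t) =
    2 * (cos (t / 2) * sin ((1 - 2 * s) * t / 2)).
  have -> : (1 - s) * t = t / 2 + (1 - 2 * s) * t / 2 by field.
  have -> : s * t = t / 2 - (1 - 2 * s) * t / 2 by field.
  by rewrite sinD sinB; ring.
have pi0 := @pi_gt0 R.
rewrite !mulr_ge0//.
  by apply: cos_ge0_pihalf; move: t0 tpi; lra.
apply: sin_ge0_pi.
have : 0 <= (1 - 2 * s) * t by rewrite mulr_ge0 ?(ltW t0)//; lra.
have : (1 - 2 * s) * t <= 1 * t by rewrite ler_pM2r//; lra.
move: tpi; lra.
Qed.

(** The chord inequality between [(1 - s) * t] and [t] gives [|B| <= 1 / (1 - s) <= 2]. The bound of
    [modBz_le] is useless here: [k * t <= sin (s * t)] forces [k <= s]. *)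
Lemma modBz_small a s : 0 <= a -> 0 < s -> s <= 1 / 2 ->
  modBz a 0 s t <= expR (a * ln 2).
Proof.
move=> a0 s0 s2; rewrite /modBz mul0r subr0 ler_expR ler_wpM2l//.
have s01 : 0 < s < 1 by lra.
have st0 := sin_t_gt0 t0pi; have sb0 := sin_onem_st_gt0 s01 t0pi.
rewrite /logB -ln_div ?posrE// ler_ln ?posrE ?divr_gt0//.
rewrite ler_pdivrMr//.
have : (1 - s) * t <= t by rewrite ger_pMl//; lra.
have b0 : 0 < (1 - s) * t by rewrite mulr_gt0//; lra.
move/(sin_chord b0)/(_ (ltW tpi)).
rewrite mulrAC mulrC ler_pM2l// => h.
apply: (@le_trans _ _ (2 * ((1 - s) * sin t))); last by rewrite ler_pM2l.
have : (1/2) * sin t <= (1 - s) * sin t by rewrite ler_pM2r//; lra.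
lra.
Qed.

Lemma ImBz_small a s : 0 <= a -> 0 < s -> s <= 1 / 2 ->
  `|ImBz a 0 s t| <= expR (a * ln 2) * (a * (s * t)).
Proof.
move=> a0 s0 s2; apply: le_trans (ImBz_le_t _ t0pi _ _) _.
rewrite subr0 (ger0_norm (mulr_ge0 a0 (ltW s0))) -mulrA.
by rewrite ler_wpM2r ?modBz_small// !mulr_ge0// ltW.
Qed.

(** [s * cot (s * t)] is of order [1 / t] and [Im B^a] of order [s * t]; the surviving factor [s]
    yields the limit 0 in [cform_cvg]. *)
Lemma cot_ImBz_small a s : 0 <= a -> 0 < s -> s <= 1 / 2 ->
  `|s * cot (s * t) * ImBz a 0 s t| <= expR (a * ln 2) * a * (pi / 2) * s.
Proof.
move=> a0 s0 s2; have s01 : 0 < s < 1 by lra.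
have sa0 := sin_st_gt0 s01 t0pi; have pi0 := @pi_gt0 R.
have p2 : 0 < 2 / pi :> R by rewrite divr_gt0.
have hc : `|cot (s * t)| <= (2 / pi * s * t)^-1.
  apply: (@cot_bound R t (2 / pi * s) t0pi); first by rewrite mulr_gt0.
  by rewrite -(mulrA (2 / pi)) st_le_sin.
rewrite (normrM (s * _)) (normrM s) (gtr0_norm s0).
apply: (@le_trans _ _ (s * (2 / pi * s * t)^-1 * (expR (a * ln 2) * (a * (s * t))))).
  apply: ler_pM => //; first by rewrite mulr_ge0// ltW.
    by rewrite ler_pM2l.
  exact: ImBz_small.
have := lt0r_neq0 pi0; move: (pi : R) => q q0.
rewrite le_eqVlt; apply/orP; left; apply/eqP; field.
by rewrite q0 (lt0r_neq0 t0) (lt0r_neq0 s0).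
Qed.

Lemma cform_small a s : 0 <= a -> 0 < s -> s <= 1 / 2 ->
  `|cform a 0 s t| <= expR (a * ln 2) * (1 + a * pi).
Proof.
move=> a0 s0 s2; have s01 : 0 < s < 1 by lra.
have pi0 := @pi_gt0 R.
have p2 : 0 < 2 / pi :> R by rewrite divr_gt0.
have E0 := expR_ge0 (a * ln 2).
have h1 : `|ReBz a 0 s t| <= expR (a * ln 2).
  by apply: (le_trans (ReBz_le _ _ _ _)); exact: modBz_small.
have h2 := cot_ImBz_small a0 s0 s2.
have h3 : `|(1 - s) * cot ((1 - s) * t) * ImBz a 0 s t| <=
    expR (a * ln 2) * a * (pi / 2).
  (* A crude bound of order [1 / (s t)], affordable because [Im B^a] is of order [s t]. *)
  have hc : `|cot ((1 - s) * t)| <= (2 / pi * s * t)^-1.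
    apply: (@cot_bound R t (2 / pi * s) t0pi); first by rewrite mulr_gt0.
    by rewrite -(mulrA (2 / pi)) (le_trans (st_le_sin s0 s2))// sin_st_le_onem.
  rewrite (normrM ((1 - s) * _)) (normrM (1 - s)) (@gtr0_norm _ (1 - s)); last lra.
  apply: (@le_trans _ _ (1 * (2 / pi * s * t)^-1 * (expR (a * ln 2) * (a * (s * t))))).
    apply: ler_pM => //; first by rewrite mulr_ge0//; lra.
      by apply: ler_pM => //; lra.
    exact: ImBz_small.
  have := lt0r_neq0 pi0; move: (pi : R) => q q0.
  rewrite le_eqVlt; apply/orP; left; apply/eqP; field.
  by rewrite q0 (lt0r_neq0 t0) (lt0r_neq0 s0).
have h4 : expR (a * ln 2) * a * (pi / 2) * s <= expR (a * ln 2) * a * (pi / 2).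
  by rewrite ler_piMr ?mulr_ge0 ?divr_ge0 ?(ltW pi0)//; lra.
rewrite /cform /dlogz mulrBl.
apply: le_trans (ler_normD _ _) _.
have := ler_normB (s * cot (s * t) * ImBz a 0 s t)
  ((1 - s) * cot ((1 - s) * t) * ImBz a 0 s t).
lra.
Qed.

Lemma cform_cvg a (u : R^nat) : 0 <= a -> (forall n, 0 < u n <= 1 / 2) ->
  u n @[n --> \oo] --> (0 : R) -> cform a 0 (u n) t @[n --> \oo] --> (1 : R).
Proof.
move=> a0 u01 u0.
have st0 := sin_t_gt0 t0pi.
have clin : (1 - u n) * t @[n --> \oo] --> t.
  rewrite -[X in _ --> X]mul1r; apply: cvgM; last exact: cvg_cst.
  by rewrite -[X in _ --> X](subr0 1); apply: cvgB => //; exact: cvg_cst.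
have csin : sin ((1 - u n) * t) @[n --> \oo] --> sin t.
  exact: (cvg_comp (fun n => (1 - u n) * t) sin clin (@continuous_sin R t)).
have ccos : cos ((1 - u n) * t) @[n --> \oo] --> cos t.
  exact: (cvg_comp (fun n => (1 - u n) * t) cos clin (@continuous_cos R t)).
have carg : (a * u n - 0) * t @[n --> \oo] --> (0 : R).
  rewrite -[X in _ --> X](mul0r t); apply: cvgM; last exact: cvg_cst.
  rewrite -[X in _ --> X](subr0 0); apply: cvgB; last exact: cvg_cst.
  by rewrite -[X in _ --> X](mulr0 a); apply: cvgM => //; exact: cvg_cst.
have cmod : modBz a 0 (u n) t @[n --> \oo] --> (1 : R).
  have cexp : a * logB (u n) t - 0 * logz (u n) t @[n --> \oo] --> (0 : R).
    rewrite (_ : (fun _ => _) = fun n => a * logB (u n) t); last first.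
      by apply/funext => n; rewrite mul0r subr0.
    rewrite -[X in _ --> X](mulr0 a); apply: cvgM; first exact: cvg_cst.
    rewrite -[X in _ --> X](subrr (ln (sin t))); apply: cvgB; first exact: cvg_cst.
    exact: (cvg_comp (fun n => sin ((1 - u n) * t)) (@ln R) csin (continuous_ln st0)).
  rewrite -[X in _ --> X](@expR0 R).
  exact: (cvg_comp (fun n => a * logB (u n) t - 0 * logz (u n) t) expR cexp
    (@continuous_expR R 0)).
have cRe : ReBz a 0 (u n) t @[n --> \oo] --> (1 : R).
  rewrite -[X in _ --> X]mulr1; apply: cvgM => //.
  rewrite -[X in _ --> X](@cos0 R).
  exact: (cvg_comp (fun n => (a * u n - 0) * t) cos carg (@continuous_cos R 0)).
have cIm : ImBz a 0 (u n) t @[n --> \oo] --> (0 : R).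
  rewrite -[X in _ --> X](mulr0 1); apply: cvgM => //.
  rewrite -[X in _ --> X](@sin0 R).
  exact: (cvg_comp (fun n => (a * u n - 0) * t) sin carg (@continuous_sin R 0)).
rewrite -[X in _ --> X]addr0; apply: cvgD => //.
rewrite (_ : (fun _ => _) = fun n => u n * cot (u n * t) * ImBz a 0 (u n) t -
  (1 - u n) * cot ((1 - u n) * t) * ImBz a 0 (u n) t); last first.
  by apply/funext => n; rewrite mulrBl.
rewrite -[X in _ --> X](subr0 0); apply: cvgB.
  (* [cot (u n * t)] diverges, so this product is squeezed instead of being treated factor by
     factor. *)
  apply: norm_cvg0.
  apply: (@squeeze_cvgr _ _ _ _ (cst 0) (fun n => expR (a * ln 2) * a * (pi / 2) * u n)).
  - apply: nearW => n; rewrite normr_ge0/=; have /andP[h1 h2] := u01 n.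
    exact: cot_ImBz_small.
  - exact: cvg_cst.
  - rewrite -[X in _ --> X](mulr0 (expR (a * ln 2) * a * (pi / 2))).
    by apply: cvgM => //; exact: cvg_cst.
rewrite -[X in _ --> X](mulr0 ((1 - 0) * (cos t / sin t))); apply: cvgM => //.
apply: cvgM; first by apply: cvgB => //; exact: cvg_cst.
apply: cvgM => //; apply: cvgV => //; exact: lt0r_neq0.
Qed.

End small_s.

Lemma cint0 a s : 0 < a -> 0 < s < 1 -> cint s a 0 = pi.
Proof.
move=> a0 s01; have [s0 s1] := andP s01.
(* The offset 2 places the sequence in []0, 1/2]], where the small [s] bounds hold. *)
pose u n : R := (n.+2%:R)^-1.
have u01 n : 0 < u n <= 1 / 2.
  by rewrite /u invr_gt0 ltr0n/= div1r lef_pV2 ?posrE// ler_nat.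
have u0 : u n @[n --> \oo] --> (0 : R).
  have := @cvg_harmonic R; rewrite -(cvg_shiftn 1).
  by under eq_fun do rewrite /harmonic addn1.
have uc n : cint (u n) a 0 = cint s a 0.
  have /andP[h1 h2] := u01 n.
  have [us|su] := leP (u n) s; first exact: cint_const.
  by apply/esym/cint_const => //; [exact: ltW|lra].
have mD : measurable D by exact: measurable_itv.
have a0' := ltW a0.
pose C := expR (a * ln 2) * (1 + a * pi).
have C0 : 0 <= C.
  by rewrite mulr_ge0 ?expR_ge0// addr_ge0// mulr_ge0// pi_ge0.
have ui n : mu.-integrable D (EFin \o cform a 0 (u n)).
  by apply: integrable_cform => //; have := u01 n; lra.
have iC : mu.-integrable D (EFin \o cst C).
  apply: (@integrable_bounded_continuous_0pi R (cst C) C).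
    by move=> t _; rewrite /cst (ger0_norm C0).
  by move=> t _; exact: cvg_cst.
have cv : {ae mu, forall t, D t ->
    (fun n => (cform a 0 (u n) t)%:E) @ \oo --> (cst 1%E t : \bar R)}.
  apply: aeW => t /itv0pi tt; apply: cvg_EFin; first exact: nearW.
  exact: cform_cvg.
have dom : {ae mu, forall t n, D t ->
    (`|(cform a 0 (u n) t)%:E| <= (EFin \o cst C) t)%E}.
  apply: aeW => t n /itv0pi tt; rewrite lee_fin.
  by have /andP[h1 h2] := u01 n; exact: cform_small.
have [_ _] := @dominated_convergence _ (measurableTypeR R) R mu D mD
  (fun n t => (cform a 0 (u n) t)%:E) (cst 1%E) (EFin \o cst C)
  (fun n => measurable_int _ (ui n)) (measurable_cst _) cv iC dom.
rewrite integral_cst// mul1e [X in _ --> X]lebesgue_measure_0pi => h.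
have h' : \int[mu]_(t in D) cform a 0 (u n) t @[n --> \oo] --> (pi : R).
  exact: fine_cvg h.
have h'' : \int[mu]_(t in D) cform a 0 (u n) t @[n --> \oo] --> cint s a 0.
  rewrite (_ : (fun _ => _) = fun=> cint s a 0); first exact: cvg_cst.
  by apply/funext => n; exact: uc.
exact: (cvg_unique (@Rhausdorff R) h'' h').
Qed.

End residue.

(** * Moments of the contour measure *)

Section moments.
Context {R : realType}.
Implicit Types (m j a s t p : R).
Notation mu := (@lebesgue_measure R).
Local Notation D := (`]0, pi[%classic : set R).

(** [cint_rec] lowers both exponents together until [cint0] applies to [m - j > 0]; the value is
    [pi] times the generalised binomial coefficient [C(m, j)]. *)
Lemma cint_nat s m (j : nat) : 0 < s < 1 -> j%:R < m ->
  cint s m j%:R = pi * (\prod_(i < j) (m - i%:R)) / j`!%:R.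
Proof.
move=> s01; elim: j m => [|j IH] m jm.
  by rewrite big_ord0 fact0 cint0// divr1 mulr1.
rewrite -natr1 in jm.
have j0 : (0 : R) <= j%:R by rewrite ler0n.
have := @cint_rec R s s01 m j.+1%:R; rewrite -natr1 addrK.
move=> /(_ _ _)/wrap[]; [lra|lra|].
rewrite IH; last lra.
rewrite big_ord_recl subr0 factS natrM.
under [in X in _ -> _ = X]eq_bigr => i _.
  rewrite (_ : m - (lift ord0 i)%:R = m - 1 - i%:R); last first.
    by rewrite /= /bump /= natrD opprD addrA.
  over.
move=> h.
have j1 : (j%:R + 1 : R) != 0 by rewrite lt0r_neq0//; lra.
apply: (mulfI j1); rewrite h -natr1.
have := @pi_gt0 R; move: (pi : R) => q q0.
field.
by rewrite j1 pnatr_eq0 -lt0n fact_gt0.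
Qed.

(** The shape [(p - 1) / m * C(m, n)] with [m = (n + 1) p - 1], suited to [cint_nat]: the division
    by [m] cancels the factor [i = 0] of the binomial product. *)
Lemma fuss_catalan_number_prod p (n : nat) : 1 < p ->
  fuss_catalan_number p (p - 1) n =
  (p - 1) * (n.+1%:R * p - 1)^-1 *
  \prod_(i < n) (n.+1%:R * p - 1 - i%:R) / n`!%:R.
Proof.
move=> p1; rewrite /fuss_catalan_number; case: n => [|k].
  by rewrite big_ord0 fact0 divr1 mulr1 mul1r divff// subr_eq0 gt_eqF.
have m0 : k.+2%:R * p - 1 != 0 :> R.
  have : 1 * p <= k.+2%:R * p by rewrite ler_pM2r ?ler1n//; lra.
  by move=> h; rewrite lt0r_neq0//; lra.
rewrite big_ord_recl subr0 big_add1 big_mkord.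
rewrite [in LHS](eq_bigr (fun i : 'I_k => k.+2%:R * p - 1 - (lift ord0 i)%:R)).
  have : (k.+1`!%:R : R) != 0 by rewrite pnatr_eq0 -lt0n fact_gt0.
  move: m0 (\prod_(i < k) _) (k.+1`!%:R : R); move: (k.+2%:R * p - 1) => m m0 pr f f0.
  by field; rewrite m0 f0.
by move=> i _; rewrite lift0 -(natr1 k.+1); ring.
Qed.

Definition rho s t : R := expR (s^-1 * logB s t - logz s t).

Definition weight s t : R :=
  (s * sin ((1 - s) * t) ^+ 2 + (1 - s) * sin (s * t) ^+ 2) / (pi * sin t ^+ 2).

Lemma rho_ge0 s t : 0 <= rho s t. Proof. exact: expR_ge0. Qed.

Lemma weight_ge0 s t : 0 <= s <= 1 -> 0 <= weight s t.
Proof.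
move=> /andP[s0 s1]; rewrite /weight divr_ge0//.
  by rewrite addr_ge0// mulr_ge0 ?sqr_ge0// subr_ge0.
by rewrite mulr_ge0 ?pi_ge0// sqr_ge0.
Qed.

(* pi * weight is the derivative of Im (-1/B), and rho = B^(1/s) / z is real. *)
Lemma rho_weight s t (n : nat) : 0 < s < 1 -> 0 < t < pi ->
  rho s t ^+ n.+1 * (pi * weight s t) =
  cform (n.+1%:R / s - 1) n%:R s t
  - (s * ReBz (n.+1%:R / s - 1) n%:R s t
     + dlogB s t * ImBz (n.+1%:R / s - 1) n%:R s t).
Proof.
move=> s01 tt; have [s0 s1] := andP s01.
have a0 := sin_st_gt0 s01 tt; have b0 := sin_onem_st_gt0 s01 tt.
have t0 := sin_t_gt0 tt.
have sn0 := lt0r_neq0 s0.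
(* With [m = (n + 1) / s - 1], [rho^(n+1) = B^m z^-n * (B / z)]. Since
   [dz / z - dB / B = dB / (z B)], the right-hand side is [Im (rho^(n+1) dB / B^2)]. *)
have -> : rho s t ^+ n.+1 =
    modBz (n.+1%:R / s - 1) n%:R s t * (sin t / sin (s * t)).
  rewrite -expRM_natl /modBz -[X in _ = _ * X]lnK; last by rewrite posrE divr_gt0.
  rewrite -expRD; congr expR.
  by rewrite ln_div ?posrE// /logB /logz -natr1; field.
rewrite /cform /ReBz /ImBz.
have -> : ((n.+1%:R / s - 1) * s - n%:R) * t = (1 - s) * t.
  by rewrite -natr1; field.
rewrite /weight /dlogz /dlogB /cot.
move: (modBz _ _ _ _) => M.
have := cos2Dsin2 (s * t); have := cos2Dsin2 ((1 - s) * t).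
move: t0 a0 b0; rewrite (cos_tE s t) (sin_tE s t).
have := @pi_gt0 R.
move: (sin (s * t)) (cos (s * t)) (sin ((1 - s) * t)) (cos ((1 - s) * t)) (pi : R).
move=> sa ca sb cb q q0 t0 a0 b0 hb ha.
have t0' := lt0r_neq0 t0; have a0' := lt0r_neq0 a0; have b0' := lt0r_neq0 b0.
have q0' := lt0r_neq0 q0.
have hb' : sb ^+ 2 = 1 - cb ^+ 2 by rewrite -hb; ring.
have ha' : sa ^+ 2 = 1 - ca ^+ 2 by rewrite -ha; ring.
field: ha' hb'.
by rewrite t0' a0' b0'.
Qed.

(** Up to an exact term, [m] times the integrand is [(m - n) / pi] times [cform m n]. This leaves
    [(m - n) / m * C(m, n)], where [m - n = (n + 1) (p - 1)] and [p = 1 / s]. *)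
Lemma moment_rho s (n : nat) : 0 < s < 1 ->
  mu.-integrable D (EFin \o (fun t => rho s t ^+ n.+1 * weight s t)) /\
  \int[mu]_(t in D) (rho s t ^+ n.+1 * weight s t) =
  n.+1%:R * fuss_catalan_number s^-1 (s^-1 - 1) n.
Proof.
move=> s01; have [s0 s1] := andP s01.
have p1 : 1 < s^-1 by rewrite invf_gt1.
set m := n.+1%:R / s - 1.
have n0 : (0 : R) <= n%:R by rewrite ler0n.
have mn : m - n%:R = n.+1%:R * (s^-1 - 1) by rewrite /m -natr1; ring.
have mn0 : 0 < m - n%:R by rewrite mn mulr_gt0 ?subr_gt0// ltr0n.
have m0 : 0 < m by lra.
have [C C0 hC] := cform_bounded s01 (ltW m0) n0.
have pi0 := @pi_gt0 R.
have s01' : 0 <= s <= 1 by lra.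
(* Minus the derivative of [ImBz m n]; it trades the [dB / B] term of [rho_weight] for [cform m n].
   The exponents [m - 1] and [n - 1] may be negative, so [cform_bounded] does not control it. *)
pose g t := n%:R * cform m n%:R s t - m * cform (m - 1) (n%:R - 1) s t.
have gE t : 0 < t < pi -> m * (rho s t ^+ n.+1 * (pi * weight s t)) =
    g t + (m - n%:R) * cform m n%:R s t.
  by move=> tt; rewrite (rho_weight n s01 tt) -/m /g cform_pred//; ring.
have iC := integrable_cform s01 (ltW m0) n0.
have mD : measurable D by exact: measurable_itv.
have [ig g0] : mu.-integrable D (EFin \o g) /\ \int[mu]_(t in D) g t = 0.
  apply: (@FTC_oo_vanish R g (fun t => - ImBz m n%:R s t) 0 pi
    ((m - n%:R) * C) pi0).
  (* The lower bound on [g] comes from [rho^(n+1) * weight >= 0] and the boundedness of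
     [cform m n]. *)
  - move=> t /itv0pi tt; have := hC t tt; rewrite ler_norml => /andP[_ h].
    have h1 : (m - n%:R) * cform m n%:R s t <= (m - n%:R) * C.
      by rewrite ler_pM2l.
    have : 0 <= m * (rho s t ^+ n.+1 * (pi * weight s t)).
      rewrite mulr_ge0 ?(ltW m0)// mulr_ge0 ?exprn_ge0 ?rho_ge0//.
      by rewrite mulr_ge0 ?(ltW pi0)// weight_ge0.
    by rewrite gE//; lra.
  - move=> t /itv0pi tt; apply: cvgB; apply: cvgM; try exact: cvg_cst;
      exact: continuous_cform.
  - move=> t /itv0pi tt.
    have h := is_deriveN (is_derive_ImBz_cform s01 tt m n%:R).
    by apply: (is_derive_eq h); rewrite /g opprB.
  - by rewrite -[X in _ --> X]oppr0; apply: cvgN; apply: ImBz_cvg0 => //; exact: ltW.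
  - by rewrite -[X in _ --> X]oppr0; apply: cvgN; exact: ImBz_cvgpi.
have iZ c f : mu.-integrable D (EFin \o f) ->
    mu.-integrable D (EFin \o (fun t => c * f t)).
  by move=> i; exact: (@integrableZl _ _ _ mu D mD c (EFin \o f)).
have iD f h : mu.-integrable D (EFin \o f) -> mu.-integrable D (EFin \o h) ->
    mu.-integrable D (EFin \o (fun t => f t + h t)).
  move=> i1 i2.
  have : mu.-integrable D ((EFin \o f) \+ (EFin \o h))%E by exact: integrableD.
  by [].
have i1 := iZ (m - n%:R) _ iC.
have i2 := iZ (m * pi)^-1 _ (iD _ _ ig i1).
have eD t : D t -> rho s t ^+ n.+1 * weight s t =
    (m * pi)^-1 * (g t + (m - n%:R) * cform m n%:R s t).
  move=> /itv0pi tt; rewrite -gE//; have := lt0r_neq0 pi0.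
  move: (pi : R) (weight s t) (rho s t ^+ _) => q w r q0.
  by field; rewrite q0 lt0r_neq0.
split.
  by apply: eq_integrable i2 => // t /set_mem tD /=; rewrite eD.
rewrite (_ : \int[mu]_(t in D) _ =
    \int[mu]_(t in D) ((m * pi)^-1 * (g t + (m - n%:R) * cform m n%:R s t))); last first.
  by apply: eq_Rintegral => t /set_mem tD; exact: eD.
rewrite RintegralZl//; last exact: iD.
rewrite RintegralD// g0 add0r RintegralZl// -/(cint s m n%:R).
rewrite cint_nat//; last by lra.
rewrite mn.
have e1 (q pr m' f c r : R) : f != 0 -> m' != 0 -> q != 0 ->
    (m' * q)^-1 * (c * r * (q * pr / f)) = c * (r * m'^-1 * pr / f).
  by move=> f0 m'0 q0; field; rewrite f0 m'0 q0.
rewrite e1 ?(lt0r_neq0 pi0) ?(lt0r_neq0 m0) ?pnatr_eq0 -?lt0n ?fact_gt0//.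
congr (_ * _).
by rewrite [RHS]fuss_catalan_number_prod.
Qed.

End moments.

(** * Determinacy of compactly supported moment problems *)

Section step_polynomials.
Context {R : realType}.
Implicit Types (x y u c L : R).

Lemma bernoulli_ineq x (n : nat) : -1 <= x -> 1 + n%:R * x <= (1 + x) ^+ n.
Proof.
move=> x1; elim: n => [|n IH]; first by rewrite mul0r addr0 expr0.
have x0 : 0 <= 1 + x by lra.
rewrite exprSr; apply: le_trans (ler_wpM2r x0 IH).
have : 0 <= n%:R * (x * x) by rewrite mulr_ge0 ?ler0n// -expr2 sqr_ge0.
rewrite -natr1; lra.
Qed.

Lemma cvg_natr_expr x : 0 <= x < 1 -> n%:R * x ^+ n @[n --> \oo] --> (0 : R).
Proof.
rewrite le_eqVlt => /andP[/predU1P[<-|x0] x1].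
  rewrite (_ : (fun _ => _) = fun=> 0); first exact: cvg_cst.
  by apply/funext => -[|n]; rewrite ?mul0r// expr0n mulr0.
(* With [x = y^2], Bernoulli's inequality for [y^-n] bounds [n y^n], and the other factor [y^n]
   provides the decay. *)
pose y := Num.sqrt x.
have y0 : 0 < y by rewrite sqrtr_gt0.
have y1 : y < 1 by rewrite -sqrtr1 ltr_sqrt.
have xy : x = y * y by rewrite -expr2 sqr_sqrtr// ltW.
pose d := y^-1 - 1.
have d0 : 0 < d by rewrite subr_gt0 invf_gt1.
have h n : n%:R * x ^+ n <= d^-1 * y ^+ n.
  rewrite xy exprMn mulrA ler_pM2r ?exprn_gt0//.
  rewrite -[leRHS]mul1r ler_pdivlMr//.
  have := @bernoulli_ineq d n; rewrite /d (_ : 1 + (y^-1 - 1) = y^-1); last by ring.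
  move=> /(_ _)/wrap[]; first by move: d0; rewrite /d; lra.
  rewrite exprVn => hb.
  have yn0 : 0 < y ^+ n by rewrite exprn_gt0.
  have : n%:R * (y^-1 - 1) <= (y ^+ n)^-1 by lra.
  by rewrite -[leRHS]mul1r ler_pdivlMr// => h1; rewrite mulrAC.
apply: (@squeeze_cvgr _ _ _ _ (cst 0) (fun n => d^-1 * y ^+ n)).
- by apply: nearW => n; rewrite h andbT mulr_ge0 ?ler0n// exprn_ge0// ltW.
- exact: cvg_cst.
- rewrite -[X in _ --> X](mulr0 d^-1); apply: cvgM; first exact: cvg_cst.
  by apply: cvg_expr; rewrite ger0_norm// ltW.
Qed.

(* The factor n in the exponent makes the limit 0, and not 1/e, at u = 1/2. *)
Definition step_seq u (n : nat) : R := (1 - u ^+ n) ^+ (n * 2 ^ n).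

Lemma step_seq_itv u n : 0 <= u <= 1 -> 0 <= step_seq u n <= 1.
Proof.
move=> /andP[u0 u1].
have h0 : 0 <= 1 - u ^+ n by rewrite subr_ge0 exprn_ile1.
by rewrite exprn_ge0//= exprn_ile1// gerBl exprn_ge0.
Qed.

(** Put [v = u^n] and [N = n 2^n], so that [N v = n (2 u)^n]. For [u < 1/2], Bernoulli gives
    [(1 - v)^N >= 1 - n (2 u)^n]. Otherwise [(1 - v)^N (1 + v)^N <= 1], while
    [(1 + v)^N >= 1 + n (2 u)^n >= n + 1]. *)
Lemma step_seq_cvg u : 0 <= u <= 1 ->
  step_seq u n @[n --> \oo] --> (((u < 1 / 2)%R)%:R : R).
Proof.
move=> /andP[u0 u1].
have E n : (n * 2 ^ n)%:R * u ^+ n = n%:R * (2 * u) ^+ n :> R.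
  by rewrite natrM natrX exprMn mulrA.
have [u2|u2] := ltP u (1 / 2).
- apply: (@squeeze_cvgr _ _ _ _ (fun n => 1 - n%:R * (2 * u) ^+ n) (cst 1)).
  + apply: nearW => n; apply/andP; split; last first.
      by have /andP[] := step_seq_itv n (introT andP (conj u0 u1)).
    rewrite -E -mulrN; apply: bernoulli_ineq.
    by rewrite lerN2 exprn_ile1.
  + rewrite -[X in _ --> X]subr0; apply: cvgB; first exact: cvg_cst.
    by apply: cvg_natr_expr; lra.
  + exact: cvg_cst.
- apply: (@squeeze_cvgr _ _ _ _ (cst 0) (fun n => (n.+1%:R)^-1)).
  + apply: nearW => n; apply/andP; split.
      by have /andP[] := step_seq_itv n (introT andP (conj u0 u1)).
    have un0 : 0 <= u ^+ n by rewrite exprn_ge0.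
    have un1 : u ^+ n <= 1 by rewrite exprn_ile1.
    have h1 : n.+1%:R <= (1 + u ^+ n) ^+ (n * 2 ^ n).
      apply: le_trans (@bernoulli_ineq (u ^+ n) (n * 2 ^ n) _); last by lra.
      rewrite E -natr1 addrC lerD2l -[leLHS]mulr1 ler_wpM2l ?ler0n//.
      by rewrite exprn_ege1//; lra.
    rewrite -[leRHS]mul1r ler_pdivlMr ?ltr0n//.
    apply: (@le_trans _ _ (step_seq u n * (1 + u ^+ n) ^+ (n * 2 ^ n))).
      rewrite ler_wpM2l//.
      by have /andP[] := step_seq_itv n (introT andP (conj u0 u1)).
    rewrite -exprMn exprn_ile1//; first by rewrite mulr_ge0; lra.
    have : 0 <= u ^+ n * u ^+ n by rewrite mulr_ge0.
    lra.
  + exact: cvg_cst.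
  + exact: cvg_harmonic.
Qed.

(* The affine map sends c to 1/2 and [-L, L] into [0, 1]. *)
Definition step_poly L c (n : nat) : {poly R} :=
  (1%:P - ((2 * (L + `|c|))^-1 *: 'X + (1 / 2 - c / (2 * (L + `|c|)))%:P) ^+ n)
    ^+ (n * 2 ^ n).

Lemma step_polyE L c n x :
  (step_poly L c n).[x] = step_seq (1 / 2 + (x - c) / (2 * (L + `|c|))) n.
Proof.
rewrite /step_poly /step_seq horner_exp hornerD hornerN horner_exp hornerD.
by rewrite hornerZ hornerX !hornerC; congr ((1 - _ ^+ n) ^+ _); ring.
Qed.

Lemma step_poly_affine L c x : 0 < L -> `|x| <= L ->
  let u := 1 / 2 + (x - c) / (2 * (L + `|c|)) in
  0 <= u <= 1 /\ (u < 1 / 2) = (x < c).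
Proof.
move=> L0 xL u; rewrite {}/u; have c0 := normr_ge0 c.
have M0 : 0 < 2 * (L + `|c|) by lra.
split; last by rewrite gtrDl pmulr_llt0 ?invr_gt0// subr_lt0.
have /ler_normlP[h1 h2] := le_trans (ler_normB x c) (lerD xL (lexx _)).
have e1 : (x - c) / (2 * (L + `|c|)) <= 1 / 2.
  by rewrite ler_pdivrMr//; lra.
have e2 : - (1 / 2) <= (x - c) / (2 * (L + `|c|)).
  by rewrite ler_pdivlMr//; lra.
by move: ((x - c) / _) e1 e2 => z ? ?; lra.
Qed.

End step_polynomials.

Section determinacy.
Context {R : realType}.
Implicit Types (m : {measure set (measurableTypeR R) -> \bar R}).
Implicit Types (L c : R) (h : R -> R).
Local Notation D L := (`[- L, L]%classic : set (measurableTypeR R)).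

Lemma bounded_integrableM m h (f : R -> R) L : m.-integrable (D L) (EFin \o h) ->
  continuous f -> m.-integrable (D L) (EFin \o (fun x : R => f x * h x)).
Proof.
move=> ih cf.
have mf : measurable_fun (D L) f.
  by apply: measurable_funTS; exact: continuous_measurable_fun.
have bf : [bounded f x | x in D L].
  have cD : compact (f @` (`[- L, L]%classic : set R)).
    apply: continuous_compact; first exact: continuous_subspaceT.
    exact: segment_compact.
  have := compact_bounded cD; rewrite /bounded_set /=.
  move=> [M [Mr hM]]; exists M; split => // K MK x xD.
  by apply: hM => //; exists x.
have := @integrableMr _ (measurableTypeR R) R m (D L) (measurable_itv _) f
  (EFin \o h) mf bf ih.
by [].
Qed.

Lemma Rintegral_horner m h L (P : {poly R}) :
  m.-integrable (D L) (EFin \o h) ->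
  \int[m]_(x in D L) (P.[x] * h x) =
  \sum_(i < size P) P`_i * \int[m]_(x in D L) (x ^+ i * h x).
Proof.
move=> ih.
have mD : measurable (D L) by exact: measurable_itv.
have cX i : continuous (fun x : R => x ^+ i) by exact: exprn_continuous.
under [LHS]eq_Rintegral => x _ do rewrite horner_coef mulr_suml.
elim: (size P) => [|n IH].
  rewrite big_ord0.
  rewrite (_ : (fun _ => _) = fun=> 0); first by rewrite Rintegral_cst// mul0r.
  by apply/funext => x; rewrite big_ord0.
rewrite big_ord_recr/= -IH -RintegralZl//; last exact: bounded_integrableM.
rewrite -RintegralD//.
- by apply: eq_Rintegral => x _; rewrite big_ord_recr/= mulrA.
- rewrite (_ : (fun x : R => _) =
    fun x => (fun x : R => \sum_(i < n) P`_i * x ^+ i) x * h x); last first.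
    by apply/funext => x; rewrite mulr_suml.
  apply: bounded_integrableM => //.
  rewrite (_ : (fun x : R => _) = horner (\poly_(i < n) P`_i)).
    exact: continuous_horner.
  by apply/funext => x; rewrite horner_poly.
- rewrite (_ : (fun x : R => _) = fun x => (fun x : R => P`_n * x ^+ n) x * h x).
    apply: bounded_integrableM => // x.
    by apply: cvgM; [exact: cvg_cst|exact: cX].
  by apply/funext => x; rewrite mulrA.
Qed.

(** Dominated convergence. The polynomials converge at every point of the segment, [c] included, so
    atoms of [m] do no harm. The factor [h] lets the lemma serve both a measure itself ([h = 1]) and
    a density against Lebesgue measure. *)
Lemma step_poly_integral_cvg m h L c : 0 < L ->
  m.-integrable (D L) (EFin \o h) ->
  \int[m]_(x in D L) ((step_poly L c n).[x] * h x) @[n --> \oo] -->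
  \int[m]_(x in D L `&` `]-oo, c[) h x.
Proof.
move=> L0 ih.
have mD : measurable (D L) by exact: measurable_itv.
have iP n : m.-integrable (D L) (EFin \o (fun x : R => (step_poly L c n).[x] * h x)).
  by apply: bounded_integrableM => //; exact: continuous_horner.
have DL x : D L x -> `|x| <= L by rewrite /= in_itv/= ler_norml.
have mI : measurable_fun (D L) (fun x : R => (((x < c)%R)%:R * h x)%:E).
  apply/measurable_EFinP/measurable_funM; last first.
    by have /measurable_int/measurable_EFinP := ih.
  rewrite (_ : (fun x : R => _) = \1_(`]-oo, c[%classic : set R)).
    exact: measurable_indic.
  by apply/funext => x; rewrite indicE mem_setE in_itv.
have cv : {ae m, forall x, D L x ->
    ((step_poly L c n).[x] * h x)%:E @[n --> \oo] --> (((x < c)%R)%:R * h x)%:E}.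
  apply: aeW => x xD; apply: cvg_EFin; first exact: nearW.
  apply: cvgM; last exact: cvg_cst.
  have [u01 <-] := step_poly_affine c L0 (DL _ xD).
  rewrite (_ : (fun n => _) = step_seq (1 / 2 + (x - c) / (2 * (L + `|c|)))).
    exact: step_seq_cvg.
  by apply/funext => n; rewrite step_polyE.
have ig : m.-integrable (D L) (fun x => (`|h x|)%:E).
  by have := integrable_abse ih.
have dom : {ae m, forall x n, D L x ->
    (`|((step_poly L c n).[x] * h x)%:E| <= (`|h x|)%:E)%E}.
  apply: aeW => x n xD; rewrite lee_fin normrM ler_piMl//.
  have [u01 _] := step_poly_affine c L0 (DL _ xD).
  by rewrite step_polyE; have /andP[h1 h2] := step_seq_itv n u01; rewrite ger0_norm.
have [il _ hc] := @dominated_convergence _ (measurableTypeR R) R m (D L) mD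
  (fun n x => ((step_poly L c n).[x] * h x)%:E)
  (fun x => (((x < c)%R)%:R * h x)%:E) (fun x => (`|h x|)%:E)
  (fun n => measurable_int _ (iP n)) mI cv ig dom.
rewrite Rintegral_mkcondr.
rewrite (_ : \int[m]_(x in D L) _ =
    \int[m]_(x in D L) (((x < c)%R)%:R * h x)); last first.
  apply: eq_Rintegral => x _; rewrite patchE mem_setE in_itv/=.
  by case: ifP; rewrite ?mul1r ?mul0r.
apply: fine_cvg; rewrite fineK//.
exact: integrable_fin_num.
Qed.

End determinacy.

(** * Mixtures of uniform laws *)

Section uniform_mixture.
Context d (T : measurableType d) {R : realType}.
Variable m : {sigma_finite_measure set T -> \bar R}.
Variables r w : T -> R.
Hypotheses (mr : measurable_fun setT r) (mw : measurable_fun setT w).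
Hypotheses (r0 : forall t, 0 <= r t) (w0 : forall t, 0 <= w t).
Hypothesis irw : m.-integrable setT (EFin \o (fun t => r t * w t)).
Notation mu := (@lebesgue_measure R).

Let slice (x : R) (t : T) : R := if (0 < x) && (x <= r t) then w t else 0.

(* Density at x of the mixture, with weights r t * w t, of the uniform laws on
   ]0, r t] *)
Definition mixture (x : R) : R := fine (\int[m]_t (slice x t)%:E)%E.

Let slice_ge0 x t : 0 <= slice x t.
Proof. by rewrite /slice; case: ifP. Qed.

Let mslice : measurable_fun setT
  (fun z : measurableTypeR R * T => slice z.1 z.2).
Proof.
apply: measurable_fun_ifT => //; last exact: measurableT_comp mw measurable_snd.
apply: measurable_and; first exact: measurable_fun_ltr.
apply: measurable_fun_ler => //.
exact: measurableT_comp mr measurable_snd.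
Qed.

Let mslice1 x : measurable_fun setT (slice x).
Proof.
exact: (measurableT_comp mslice (measurable_pair1 (x : measurableTypeR R))).
Qed.

(** A Markov-type bound: [1 <= r t / x] where the slice is nonzero. It makes the mixture finite when
    only [r * w] is integrable; the contour weight itself is not integrable at [pi]. *)
Let slice_le x t : 0 < x -> slice x t <= x^-1 * (r t * w t).
Proof.
move=> x0; rewrite /slice x0 /=; case: ifP => [xr|_].
  by rewrite mulrA ler_peMl// mulrC ler_pdivlMr// mul1r.
by rewrite mulr_ge0 ?invr_ge0 ?(ltW x0)// mulr_ge0.
Qed.

Let mixture_fin x : (\int[m]_t (slice x t)%:E)%E \is a fin_num.
Proof.
have [x0|x0] := ltP 0 x; last first.
  rewrite integral0_eq// => t _.
  by rewrite /slice ltNge x0.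
have irw' := @integrableZl _ T R m setT measurableT x^-1 _ irw.
apply: integrable_fin_num => //.
apply: le_integrable irw' => //; first exact/measurable_EFinP.
move=> t _ /=; rewrite lee_fin ger0_norm ?slice_ge0//.
apply: le_trans (slice_le t x0) (ler_norm _).
Qed.

Lemma mixture_ge0 x : 0 <= mixture x.
Proof. by rewrite fine_ge0// integral_ge0// => t _; rewrite lee_fin. Qed.

Lemma mixtureE x : (\int[m]_t (slice x t)%:E)%E = (mixture x)%:E.
Proof. by rewrite /mixture fineK. Qed.

Lemma mixture_le0 x : x <= 0 -> mixture x = 0.
Proof.
move=> x0; rewrite /mixture integral0_eq// => t _.
by rewrite /slice ltNge x0.
Qed.

(** For each [t], increasing a positive [x] can only switch [slice x t] off. *)
Lemma mixture_nonincreasing x y : 0 < x -> x <= y -> mixture y <= mixture x.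
Proof.
move=> x0 xy; rewrite -lee_fin -!mixtureE; apply: ge0_le_integral => //.
- by move=> t _; rewrite lee_fin.
- exact/measurable_EFinP.
- exact/measurable_EFinP.
- move=> t _; rewrite lee_fin /slice x0 (lt_le_trans x0 xy)/=.
  case: ifP => yr; first by rewrite (le_trans xy yr).
  by case: ifP.
Qed.

Lemma mixture_eq0 L x : (forall t, w t != 0 -> r t <= L) -> L < x -> mixture x = 0.
Proof.
move=> rL Lx; rewrite /mixture integral0_eq// => t _.
rewrite /slice; case: ifP => // /andP[_ xr].
have [->//|/rL rt] := eqVneq (w t) 0.
by have := lt_le_trans Lx (le_trans xr rt); rewrite ltxx.
Qed.

Lemma measurable_mixture : measurable_fun (setT : set (measurableTypeR R)) mixture.
Proof.
apply: measurableT_comp => //.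
have mF : measurable_fun setT
    (fun z : measurableTypeR R * T => (slice z.1 z.2)%:E).
  exact/measurable_EFinP.
apply: (@measurable_fun_fubini_tonelli_F _ _ (measurableTypeR R) T R m _ mF).
by move=> z; rewrite lee_fin.
Qed.

Let integral_expr (k : nat) (a : R) : 0 <= a ->
  (\int[mu]_(x in `]0%R, a[) (x ^+ k)%:E = (a ^+ k.+1 / k.+1%:R)%:E)%E.
Proof.
rewrite le_eqVlt => /predU1P[<-|a0].
  by rewrite set_itvoo0 integral_set0 expr0n mul0r.
have k0 : (k.+1%:R : R) != 0 by rewrite pnatr_eq0.
have cvgX b (F : set_system R) : Filter F -> F --> (b : R) ->
    x ^+ k.+1 / k.+1%:R @[x --> F] --> b ^+ k.+1 / k.+1%:R.
  move=> FF Fb; apply: cvgM; last exact: cvg_cst.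
  exact: (cvg_comp (fun x => x) (fun x : R => x ^+ k.+1) Fb (@exprn_continuous R k.+1 b)).
have <- : a ^+ k.+1 / k.+1%:R - 0 ^+ k.+1 / k.+1%:R = a ^+ k.+1 / k.+1%:R.
  by rewrite expr0n/= mul0r subr0.
apply: (@ge0_FTC_oo R (fun x => x ^+ k) (fun x => x ^+ k.+1 / k.+1%:R) 0 a
  (0 ^+ k.+1 / k.+1%:R) (a ^+ k.+1 / k.+1%:R) a0).
- by move=> x; rewrite in_itv/= => /andP[/ltW x0 _]; rewrite exprn_ge0.
- by move=> x _; exact: exprn_continuous.
- move=> x _.
  have hX : is_derive x 1 (fun y : R => y ^+ k.+1) (k.+1%:R * x ^+ k).
    rewrite (_ : (fun y => _) = (id : R -> R) ^+ k.+1); last first.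
      by apply/funext => y; rewrite exprfctE.
    by apply: (is_derive_eq (is_deriveX k.+1 (is_derive_id x 1))); rewrite /GRing.scale/= mulr1.
  have h := is_derive_mul hX (is_derive_cstR k.+1%:R^-1 x).
  by apply: (is_derive_eq h); rewrite mulr0 addr0 mulrAC divff// mul1r.
- by apply: cvgX; apply: cvg_at_right_filter; exact: cvg_id.
- by apply: cvgX; apply: cvg_at_left_filter; exact: cvg_id.
Qed.

Lemma integral_mixture (k : nat) :
  (\int[mu]_x (x ^+ k * mixture x)%:E =
   \int[m]_t (r t ^+ k.+1 * w t / k.+1%:R)%:E)%E.
Proof.
(* The absolute value makes [F] nonnegative everywhere, as Tonelli requires; it changes nothing,
   since the slices vanish for [x <= 0]. *)
pose F (z : measurableTypeR R * T) : \bar R := (`|z.1| ^+ k * slice z.1 z.2)%:E.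
have mF : measurable_fun setT F.
  apply/measurable_EFinP/measurable_funM => //.
  by apply: measurable_funX; exact: measurableT_comp.
have F0 z : (0 <= F z)%E by rewrite lee_fin mulr_ge0.
have := @fubini_tonelli _ _ (measurableTypeR R) T R mu m F mF F0.
have -> : (\int[mu]_x \int[m]_t F (x, t) = \int[mu]_x (x ^+ k * mixture x)%:E)%E.
  apply: eq_integral => x _; rewrite /F/=.
  under eq_integral do rewrite EFinM.
  rewrite ge0_integralZl_EFin//; last first.
  - exact/measurable_EFinP.
  - by move=> t _; rewrite lee_fin.
  rewrite mixtureE -EFinM; have [x0|x0] := ltP 0 x; first by rewrite gtr0_norm.
  by rewrite mixture_le0// !mulr0.
move=> ->; apply: eq_integral => t _; rewrite /F/=.
transitivity (\int[mu]_(x in `]0%R, r t]) ((w t)%:E * (x ^+ k)%:E))%E.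
  rewrite [RHS]integral_mkcond; apply: eq_integral => x _.
  rewrite patchE mem_setE in_itv/= /slice; case: ifP => [/andP[x0 _]|_].
    by rewrite gtr0_norm// mulrC EFinM.
  by rewrite mulr0.
rewrite ge0_integralZl_EFin//.
- rewrite integral_itv_bndoo; last first.
    by apply/measurable_EFinP; exact: measurable_funX.
  by rewrite integral_expr// -EFinM; congr (_%:E); ring.
- by move=> x; rewrite /= in_itv/= => /andP[/ltW x0 _]; rewrite lee_fin exprn_ge0.
- by apply/measurable_EFinP; exact: measurable_funX.
Qed.

End uniform_mixture.

(** * Measures given by a density *)

Section density_measure.
Context {R : realType}.
Notation mu := (@lebesgue_measure R).
Variable f : R -> R.

(* The unused proofs are arguments so that the measure structure below can be
   inferred. *)
Definition density_measure of (forall x, 0 <= f x)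
    & mu.-integrable setT (EFin \o f) : set (measurableTypeR R) -> \bar R :=
  fun A => (\int[mu]_(x in A) (f x)%:E)%E.

Hypotheses (f0 : forall x, 0 <= f x) (intf : mu.-integrable setT (EFin \o f)).
Local Notation nu := (density_measure f0 intf).

Let nu0 : nu set0 = 0%E. Proof. exact: integral_set0. Qed.

Let nu_ge0 A : (0 <= nu A)%E.
Proof. by apply: integral_ge0 => x _; rewrite lee_fin. Qed.

Let nu_sigma_additive : semi_sigma_additive nu.
Proof.
move=> A mA tA mUA; rewrite /density_measure integral_bigcup//; last first.
  exact: integrableS intf.
apply: is_cvg_ereal_nneg_natsum_cond => n _ _.
by apply: integral_ge0 => x _; rewrite lee_fin.
Qed.

HB.instance Definition _ :=
  isMeasure.Build _ _ _ nu nu0 nu_ge0 nu_sigma_additive.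

End density_measure.

(** * Identification of a compactly supported law from its moments *)

Section moment_problem.
Context {R : realType}.
Notation leb := (@lebesgue_measure R).

Lemma measure_eq_Iio (m1 m2 : {measure set (measurableTypeR R) -> \bar R}) :
  (forall c : R, m1 `]-oo, c[%classic = m2 `]-oo, c[%classic) ->
  (m1 setT < +oo)%E -> forall A, measurable A -> m1 A = m2 A.
Proof.
move=> m12 m1T A mA.
apply: (@measure_unique _ R (measurableTypeR R) (@RGenInftyO.G R)
  (fun n => `]-oo, n%:R[%classic)) => //.
- exact: RGenInftyO.measurableE.
- move=> B C [b ->] [c ->]; exists (Num.min b c); apply/seteqP; split => x /=.
    by rewrite !in_itv/= lt_min => -[-> ->].
  by rewrite !in_itv/= lt_min => /andP.
- by move=> n; exists n%:R.
- apply/seteqP; split => // x _; exists (Num.truncn x).+1 => //=.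
  by rewrite in_itv/= truncnS_gt.
- by move=> B [b ->]; exact: m12.
- move=> n; apply: le_lt_trans m1T; apply: le_measure; rewrite ?inE//.
Qed.

Lemma compact_support_bounded (K : set R) : compact K ->
  exists2 L : R, 0 < L & K `<=` `[- L, L]%classic.
Proof.
move/compact_bounded => [M [Mr hM]]; exists (Num.max 0 M + 1).
  by rewrite ltr_wpDl// le_max lexx.
move=> x Kx /=; rewrite in_itv/= -ler_norml; apply: hM => //.
by apply: (@le_lt_trans _ _ (Num.max 0 M)); rewrite ?le_max ?lexx ?orbT// ltrDl.
Qed.

(** Both measures live on a common segment, where equal moments give equal integrals of [step_poly].
    In the limit the masses of all half-lines []-oo, c[] agree, and these generate the Borel
    sets. *)
Lemma density_of_moments (P : probability (measurableTypeR R) R) (K : set R)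
    (f : R -> R) (L : R) :
  compact K -> P (~` K) = 0%E ->
  (forall x, 0 <= f x) -> leb.-integrable setT (EFin \o f) ->
  (forall x, L < `|x| -> f x = 0) ->
  (forall k, (\int[P]_x (x ^+ k)%:E = \int[leb]_x (x ^+ k * f x)%:E)%E) ->
  forall A, measurable A -> P A = (\int[leb]_(x in A) (f x)%:E)%E.
Proof.
move=> cK PK f0 intf fL mom A mA.
have [L1 L10 KL1] := compact_support_bounded cK.
pose M := Num.max L L1.
have M0 : 0 < M by rewrite lt_max L10 orbT.
pose D : set (measurableTypeR R) := `[- M, M]%classic.
have mD : measurable D by exact: measurable_itv.
have mK : measurable (K : set (measurableTypeR R)) by exact: compact_measurable.
have KD : K `<=` D.
  move=> x /KL1 /=; rewrite /D /= !in_itv/= -!ler_norml => /le_trans; apply.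
  by rewrite le_max lexx orbT.
have PD : P (~` D) = 0%E.
  apply/eqP; rewrite -measure_le0 -PK; apply: le_measure; rewrite ?inE.
  - exact: measurableC.
  - exact: measurableC.
  - exact: subsetC.
have fD x : ~ D x -> f x = 0.
  move=> nD; apply: fL; rewrite ltNge; apply/negP => xL; apply: nD.
  by rewrite /D /= in_itv/= -ler_norml (le_trans xL)// le_max lexx.
have iP1 : P.-integrable D (EFin \o cst 1).
  apply: measurable_bounded_integrable => //.
  - by apply: (le_lt_trans (probability_le1 P mD)); rewrite ltry.
  - exact: bounded_cst.
have if1 : leb.-integrable D (EFin \o f) by exact: integrableS intf.
have PE (g : R -> R) : measurable_fun setT g ->
    (\int[P]_x (g x)%:E = \int[P]_(x in D) (g x)%:E)%E.
  move=> mg; rewrite [RHS]integral_mkcond.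
  apply: ae_eq_integral => //.
  - exact/measurable_EFinP.
  - apply/(measurable_restrictT _ mD); apply: measurable_funTS.
    exact/measurable_EFinP.
  - exists (~` D); split => //; first exact: measurableC.
    move=> x /= h Dx; apply: h => _; rewrite patchE mem_set//.
have fE (g : R -> R) :
    (\int[leb]_x (g x * f x)%:E = \int[leb]_(x in D) (g x * f x)%:E)%E.
  rewrite [RHS]integral_mkcond; apply: eq_integral => x _.
  rewrite patchE; case: ifPn => //; rewrite notin_setE => /fD ->.
  by rewrite mulr0.
have momR k : \int[P]_(x in D) (x ^+ k * cst 1 x) = \int[leb]_(x in D) (x ^+ k * f x).
  rewrite /Rintegral -fE -mom PE; last exact: measurable_funX.
  by under eq_integral do rewrite /cst mulr1.
have cdf c : P `]-oo, c[%classic = density_measure f0 intf `]-oo, c[%classic.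
  have mI : measurable (`]-oo, c[%classic : set (measurableTypeR R)).
    exact: measurable_itv.
  have mDI : measurable (D `&` `]-oo, c[%classic) by exact: measurableI.
  have h1 := @step_poly_integral_cvg _ _ _ _ c M0 iP1.
  have h2 := @step_poly_integral_cvg _ _ _ _ c M0 if1.
  have e12 : (fun n => \int[P]_(x in D) ((step_poly M c n).[x] * cst 1 x)) =
             (fun n => \int[leb]_(x in D) ((step_poly M c n).[x] * f x)).
    apply/funext => n; rewrite !Rintegral_horner//.
    by apply: eq_bigr => i _; rewrite momR.
  rewrite e12 in h1.
  have := cvg_unique (@Rhausdorff R) h1 h2.
  rewrite Rintegral_cst// mul1r => h3.
  have -> : P `]-oo, c[%classic = P (D `&` `]-oo, c[%classic).
    rewrite (measureDI P mI mD) [X in (X + _)%E](_ : _ = 0%E) ?add0e 1?setIC//.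
    apply/eqP; rewrite -measure_le0 -PD; apply: le_measure; rewrite ?inE.
    - exact: measurableD.
    - exact: measurableC.
    - by move=> x [].
  have -> : density_measure f0 intf `]-oo, c[%classic =
      (\int[leb]_(x in D `&` `]-oo, c[%classic) (f x)%:E)%E.
    rewrite /density_measure [LHS]integral_mkcond [RHS]integral_mkcond.
    apply: eq_integral => x _; rewrite !patchE in_setI.
    have [xD|] := boolP (x \in D); first by [].
    by rewrite notin_setE => /fD ->; rewrite if_same.
  rewrite -[LHS]fineK; last by rewrite fin_num_measure.
  rewrite h3 /Rintegral fineK//.
  by apply: integrable_fin_num => //; exact: integrableS intf.
have := @measure_eq_Iio P (density_measure f0 intf) cdf.
by rewrite [X in (X < _)%E]probability_setT ltry => /(_ isT); exact.
Qed.

End moment_problem.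

(** * The density of [mu(p, p - 1)] for [p = 1 / s > 1] *)

Section fuss_catalan_density.
Context {R : realType}.
Notation leb := (@lebesgue_measure R).
Local Notation D := (`]0, pi[%classic : set R).
Variable s : R.
Hypothesis s01 : 0 < s < 1.

(** Extension by 0 allows a mixture over the whole line: the values of [rho] outside []0, pi[] then
    have no effect. *)
Let w := weight s \_ D.

Let w_ge0 t : 0 <= w t.
Proof.
rewrite /w patchE; case: ifP => // _; apply: weight_ge0.
by case/andP: s01 => /ltW -> /ltW ->.
Qed.

Let measurable_rho : measurable_fun (setT : set (measurableTypeR R)) (rho s).
Proof.
have mls c : measurable_fun (setT : set (measurableTypeR R))
    (fun t : R => ln (sin (c * t))).
  apply: measurableT_comp; first exact: measurable_ln.
  apply: measurableT_comp; last exact: measurable_funM.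
  by apply: continuous_measurable_fun; exact: continuous_sin.
apply: measurableT_comp; first exact: measurable_expR.
apply: measurable_funB.
  apply: measurable_funM => //; apply: measurable_funB => //.
  rewrite (_ : (fun t : R => ln (sin t)) = fun t => ln (sin (1 * t))) //.
  by apply/funext => t; rewrite mul1r.
exact: measurable_funB.
Qed.

Let measurable_w : measurable_fun (setT : set (measurableTypeR R)) w.
Proof.
have mD : measurable (D : set (measurableTypeR R)) by exact: measurable_itv.
apply/(measurable_restrictT _ mD).
apply: open_continuous_measurable_fun; first exact: itv_open.
move=> t; rewrite inE/= => /itv0pi tt.
have cs c : {for t, continuous (fun t : R => sin (c * t))}.
  exact: (is_derive_continuous (is_derive_sin_comp
    (is_derive_mulc c (is_derive_idR t)))).
have st0 := lt0r_neq0 (sin_t_gt0 tt).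
apply: cvgM.
  by apply: cvgD; apply: cvgM; try exact: cvg_cst; apply: cvgM; exact: cs.
apply: cvgV; first by rewrite mulf_neq0 ?expf_neq0// lt0r_neq0// pi_gt0.
apply: cvgM; first exact: cvg_cst.
by apply: cvgM; exact: continuous_sin.
Qed.

Let integral_rho_w (k : nat) :
  (\int[leb]_t (rho s t ^+ k.+1 * w t)%:E =
   \int[leb]_(t in D) (rho s t ^+ k.+1 * weight s t)%:E)%E.
Proof.
rewrite [RHS]integral_mkcond; apply: eq_integral => t _.
by rewrite /w !patchE; case: ifP => // _; rewrite mulr0.
Qed.

Let integrable_rho_w : leb.-integrable setT (EFin \o (fun t => rho s t * w t)).
Proof.
have [i _] := moment_rho 0 s01.
have mD : measurable (D : set (measurableTypeR R)) by exact: measurable_itv.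
have : leb.-integrable setT
    ((EFin \o (fun t => rho s t ^+ 1 * weight s t)) \_ D).
  by apply/integrable_restrict => //=; rewrite setTI.
apply: eq_integrable => // t _; rewrite patchE /= /w patchE.
by case: ifP => //; rewrite mulr0.
Qed.

Definition fuss_catalan_pdf : R -> R :=
  @mixture _ (measurableTypeR R) R leb (rho s) w.

Lemma fuss_catalan_pdf_ge0 x : 0 <= fuss_catalan_pdf x.
Proof. exact: mixture_ge0. Qed.

Lemma fuss_catalan_pdf_le0 x : x <= 0 -> fuss_catalan_pdf x = 0.
Proof. exact: mixture_le0. Qed.

Lemma fuss_catalan_pdf_nonincreasing x y :
  0 < x -> x <= y -> fuss_catalan_pdf y <= fuss_catalan_pdf x.
Proof.
apply: mixture_nonincreasing => //; first exact: rho_ge0.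
Qed.

Lemma fuss_catalan_pdf_support :
  exists L, forall x, L < `|x| -> fuss_catalan_pdf x = 0.
Proof.
have [s0 s1] := andP s01; have [k k0 h] := sin_sub_lb s0 (lexx s) s1.
(* [rho] is [modBz s^-1 1], so [modBz_le] bounds it by this constant. *)
exists (expR (- (s^-1 + 1) * ln k)) => x Lx.
have [x0|x0] := leP x 0; first exact: fuss_catalan_pdf_le0.
rewrite gtr0_norm// in Lx; apply: (@mixture_eq0 _ _ R leb (rho s) w _ x _ Lx) => t.
rewrite /w patchE; case: ifP => [/set_mem /itv0pi tt _|]; last by rewrite eqxx.
have [ha hb] : k * t <= sin (s * t) /\ k * t <= sin ((1 - s) * t).
  by apply: h => //; rewrite lexx.
have := @modBz_le R s t k s01 tt k0 ha hb s^-1 1.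
rewrite /modBz mul1r; apply => //.
by rewrite invr_ge0 ltW.
Qed.

(** The factor [1 / (k + 1)] from integrating [x^k] over []0, rho]] cancels the [k + 1] of
    [moment_rho]. *)
Lemma fuss_catalan_pdf_moment (k : nat) :
  (\int[leb]_x (x ^+ k * fuss_catalan_pdf x)%:E =
   (fuss_catalan_number s^-1 (s^-1 - 1) k)%:E)%E.
Proof.
rewrite integral_mixture//; last exact: rho_ge0.
have [ik ek] := moment_rho k s01.
have k0 : (k.+1%:R : R) != 0 by rewrite pnatr_eq0.
under eq_integral do rewrite mulrC EFinM.
rewrite ge0_integralZl_EFin ?invr_ge0//.
- rewrite integral_rho_w -[X in (_ * X)%E]fineK; last exact: integrable_fin_num.
  have -> : fine (\int[leb]_(t in D) (rho s t ^+ k.+1 * weight s t)%:E)%E =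
    k.+1%:R * fuss_catalan_number s^-1 (s^-1 - 1) k by exact: ek.
  by rewrite -EFinM mulKf.
- by move=> t _; rewrite lee_fin mulr_ge0// exprn_ge0// rho_ge0.
- by apply/measurable_EFinP/measurable_funM => //; exact: measurable_funX.
Qed.

Lemma integrable_fuss_catalan_pdf :
  leb.-integrable setT (EFin \o fuss_catalan_pdf).
Proof.
apply/integrableP; split.
  by apply/measurable_EFinP; apply: measurable_mixture => //; exact: rho_ge0.
(* The total mass is [A_0 = 1], in particular finite. *)
have := fuss_catalan_pdf_moment 0.
under eq_integral do rewrite expr0 mul1r.
under [in X in _ -> X]eq_integral do rewrite /= ger0_norm ?fuss_catalan_pdf_ge0//.
by move=> ->; rewrite ltry.
Qed.

End fuss_catalan_density.

(** * The degenerate case [p = 1] *)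

Section dirac_case.
Context {R : realType}.

(** [x^2] is nonnegative with integral 0, hence vanishes almost everywhere, so the complement of 0
    is null. *)
Lemma second_moment0_dirac (P : probability (measurableTypeR R) R) :
  (\int[P]_x (x ^+ 2)%:E = 0)%E ->
  forall A, measurable A -> P A = \d_(0 : R) A.
Proof.
move=> m2 A mA.
have mX : measurable_fun (setT : set (measurableTypeR R))
    (fun x : measurableTypeR R => (x ^+ 2)%:E).
  by apply/measurable_EFinP; exact: measurable_funX.
have ae0 : ae_eq P setT (fun x : measurableTypeR R => (x ^+ 2)%:E) (cst 0%E).
  apply/ae_eq_integral_abs => //; rewrite -[RHS]m2; apply: eq_integral => x _.
  by rewrite gee0_abs// lee_fin sqr_ge0.
have m1 : measurable ([set 0] : set (measurableTypeR R)) by exact: measurable_set1.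
have P0 : P (~` [set 0]) = 0%E.
  apply/negligibleP; first exact: measurableC.
  case: ae0 => N [mN N0 sN]; exists N; split => // x /= x0; apply: sN => /= h.
  have /eqP := h I; rewrite eqe sqrf_eq0 => /eqP; exact: x0.
have hI (B : set (measurableTypeR R)) : measurable B -> ~ B (0 : R) -> P B = 0%E.
  move=> mB B0; apply/eqP; rewrite -measure_le0 -P0; apply: le_measure; rewrite ?inE//.
    exact: measurableC.
  by move=> x Bx /= x0; apply: B0; rewrite -x0.
rewrite diracE; have [/set_mem A0|/negP A0] := boolP (0 \in A); last first.
  by rewrite hI//; apply: contra_not A0 => /mem_set.
have := probability_setC P (measurableC mA); rewrite setCK => ->.
by rewrite hI ?sube0//; exact: measurableC.
Qed.

End dirac_case.

Unset Implicit Arguments.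

Theorem proposition4p5 (R : realType) (p : R) (hp : 1 <= p)
    (mu : probability (measurableTypeR R) R)
    (hmu : is_fuss_catalan_distribution p (p - 1) mu) :
  unimodal mu.
Proof.
case: hmu => -[K cK muK] mom.
move: hp; rewrite le_eqVlt => /predU1P[p1|p1].
- exists 0, 1, (fun=> 0); split => // [A mA].
  rewrite integral0_eq// adde0 mul1e.
  (* [A_2(1, 0) = 0] because of the prefactor [r = p - 1 = 0]. *)
  apply: second_moment0_dirac => //; rewrite mom /fuss_catalan_number.
  by rewrite -p1 subrr !mul0r.
- have s01 : 0 < p^-1 < 1 by rewrite invr_gt0 invf_lt1 ?p1 ?andbT//; lra.
  (* Mode 0 without atom: the density vanishes on the left of 0 and is non-increasing on the
     right. *)
  exists 0, 0, (fuss_catalan_pdf p^-1); split.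
  + by [].
  + exact: fuss_catalan_pdf_ge0.
  + move=> x y; rewrite !in_itv/= => x0 y0 _.
    by rewrite !fuss_catalan_pdf_le0// ltW.
  + move=> x y; rewrite !in_itv/= !andbT => x0 y0 xy.
    exact: fuss_catalan_pdf_nonincreasing.
  + move=> A mA; rewrite mul0e add0e.
    have [L hL] := fuss_catalan_pdf_support s01.
    apply: (density_of_moments cK muK (fuss_catalan_pdf_ge0 _)
      (integrable_fuss_catalan_pdf s01) hL) => // k.
    by rewrite mom fuss_catalan_pdf_moment// invrK.
Qed.
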